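(* Let $K_1,K_2\subset\mathbb{R}^2$ be convex bodies. Then $$\mu(K_1+K_2)^{-1}\ \ge\ \tfrac34\left(\mu(K_1)^{-1}+\mu(K_2)^{-1}\right).$$ Equality holds, for example, for $K_1=P_1$ and $K_2=P_2$, where $$P_1=\{\alpha(1,1)+\beta(-\tfrac12,\tfrac12): 0\le\alpha,\beta\le 1\},\qquad P_2=\{\alpha(-1,1)+\beta(\tfrac12,\tfrac12): 0\le\alpha,\beta\le 1\}.$$
   Context: A convex body is a non-empty compact convex set. The covering radius of a convex body $K\subset\mathbb{R}^d$ is $\mu(K)=\inf\{\mu\ge 0:\mu K+\mathbb{Z}^d=\mathbb{R}^d\}$. If $K$ is lower-dimensional, then $\mu(K)=\infty$ and one sets $\mu(K)^{-1}=0$. Here $K_1+K_2$ denotes the Minkowski sum. *)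

(* Defs.v *)
From HB Require Import structures.
From mathcomp Require Import all_boot all_order all_algebra.
From mathcomp Require Import all_classical all_reals all_analysis.

Set Implicit Arguments.
Unset Strict Implicit.
Unset Printing Implicit Defensive.

Import Order.TTheory GRing.Theory Num.Theory.
Import numFieldNormedType.Exports.

Local Open Scope classical_set_scope.
Local Open Scope ring_scope.

Definition minkowski_sum (R : realType) (d : nat) (A B : set 'rV[R]_d)
    : set 'rV[R]_d :=
  [set x + y | x in A & y in B].

Definition dilate (R : realType) (d : nat) (t : R) (A : set 'rV[R]_d)
    : set 'rV[R]_d :=
  [set t *: x | x in A].

Definition integer_lattice (R : realType) (d : nat) : set 'rV[R]_d :=
  [set z | z \is a mxOver Num.int].
Arguments integer_lattice R d : clear implicits.

Definition convex_body (R : realType) (d : nat) (K : set 'rV[R]_d) : Prop :=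
  [/\ K !=set0, compact K & convex_set K].

(* The infimum is taken in \bar R. A lower-dimensional K has no dilate whose
   lattice translates cover the space, so its covering radius is the infimum of
   the empty set, namely +oo, and the library's inverse satisfies +oo^-1 = 0. *)
Definition covering_radius (R : realType) (d : nat) (K : set 'rV[R]_d)
    : \bar R :=
  ereal_inf [set mu%:E | mu in
    [set mu : R | 0 <= mu /\
       minkowski_sum (dilate mu K) (integer_lattice R d) = setT]].

Definition vec2 (R : realType) (x y : R) : 'rV[R]_2 :=
  \row_(i < 2) [:: x; y]`_i.

Definition parallelogram (R : realType) (u v : 'rV[R]_2) : set 'rV[R]_2 :=
  [set alpha *: u + beta *: v | alpha in `[0, 1] & beta in `[0, 1]].

Definition P1 (R : realType) : set 'rV[R]_2 :=
  parallelogram (vec2 1 1) (vec2 (- 2^-1) 2^-1).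

Definition P2 (R : realType) : set 'rV[R]_2 :=
  parallelogram (vec2 (- 1) 1) (vec2 2^-1 2^-1).

Arguments P1 R : clear implicits.
Arguments P2 R : clear implicits.

(* Main.v *)
(* Let T be the triangle spanned by a basis (u, v) of Z^2. A planar convex body
   whose lattice translates cover the plane contains translates of T and -T for
   some such T (take u along a lattice direction of longest chord, normalised by
   lattice length, and slice the body parallel to u), and conversely any convex
   set containing translates of T and -T covers. If T and T' are two such
   triangles and 0 <= l <= 1, then l T + (1 - l) T', up to replacing T' by -T',
   contains a translate of (3/4) T'' for a third lattice triangle T''; the
   critical case is that of two triangles which share exactly two edge
   directions. Hence if A and B cover, then so does (4/3) (l A + (1 - l) B). *)

Require Import Defs.
From HB Require Import structures.
From mathcomp Require Import all_boot all_order all_algebra.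
From mathcomp Require Import all_classical all_reals all_analysis.
From mathcomp Require Import zify ring lra.

Set Implicit Arguments.
Unset Strict Implicit.
Unset Printing Implicit Defensive.

Import Order.TTheory GRing.Theory Num.Theory.
Import numFieldNormedType.Exports.

Local Open Scope classical_set_scope.
Local Open Scope ring_scope.

(** * Lattice triangles and coverings *)

(** Reciprocals enter through the weight [l = mu2 / (mu1 + mu2)]: then [l mu1 = (1 - l) mu2], so the
    mixture of [mu1 A] and [mu2 B] is a dilate of [A + B], and enlarging it by 4/3 gives exactly the
    claimed bound. The obstacle is that a covering needs [T''] and [-T''] for one and the same
    [T'']. So [fits] chooses the triangle from [T], [T'] and [l] alone and is used again for the
    reflected bodies; likewise the two inscribed triangles must be tied together, which takes a
    connectedness argument. For [l] outside [1/4, 3/4] one of the two triangles is large enough by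
    itself. Inside, pairs sharing an edge direction are indexed by an integer [n]: the apex of (3/4)
    T'' has to hit intervals of length 1/4 repeated with period 3/4, and a segment of length (|n| +
    1) / 4 is available for it. For |n| = 1 this just bridges the gaps of length 1/2, so there the
    argument has no slack. Without a common edge direction, and with [T] the triangle of weight at
    least 1/2, some edge of the other triangle is so long relative to [T] that it can replace the
    whole triangle. *)

Definition planar_convex {R : realType} (A : set (R * R)) :=
  forall x y x' y' t, A (x, y) -> A (x', y') -> 0 <= t -> t <= 1 ->
    A ((1 - t) * x + t * x', (1 - t) * y + t * y').

Definition covers {R : realType} (A : set (R * R)) :=
  forall x y, exists m n : int, A (x - m%:~R, y - n%:~R).

(** Vertices suffice because the sets concerned are convex. The scale may be negative: [s = -1] is
    the reflected triangle with the same edge vectors. *)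
Definition has_triangle {R : realType} (A : set (R * R)) (s : R)
    (u1 u2 v1 v2 : int) :=
  exists x y, [/\ A (x, y), A (x + s * u1%:~R, y + s * u2%:~R) &
                  A (x + s * v1%:~R, y + s * v2%:~R)].

(** Squaring treats determinants 1 and -1 by one polynomial relation, under which the determinant
    times the adjugate is the inverse matrix. *)
Definition unimodular (u1 u2 v1 v2 : int) := (u1 * v2 - u2 * v1) ^+ 2 = 1.

Section Planar.
Variable R : realType.
Implicit Types A B : set (R * R).

Lemma convex_in A x y x' y' t X Y : planar_convex A ->
  A (x, y) -> A (x', y') -> 0 <= t -> t <= 1 ->
  X = (1 - t) * x + t * x' -> Y = (1 - t) * y + t * y' -> A (X, Y).
Proof. by move=> cA ? ? ? ? -> ->; exact: cA. Qed.

Lemma convex_hseg A a b x h : planar_convex A ->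
  A (a, h) -> A (b, h) -> a <= x -> x <= b -> A (x, h).
Proof.
move=> cA Aa Ab; rewrite le_eqVlt => /predU1P[<-//|ax] xb.
have ab : 0 < b - a by lra.
apply: (convex_in (t := (x - a) / (b - a)) cA Aa Ab).
- by rewrite divr_ge0//; lra.
- by rewrite ler_pdivrMr//; lra.
- by field; lra.
- by field; lra.
Qed.

Lemma convex_vseg A a b x h : planar_convex A ->
  A (h, a) -> A (h, b) -> a <= x -> x <= b -> A (h, x).
Proof.
move=> cA; apply: (@convex_hseg [set p | A (p.2, p.1)]).
by move=> ? ? ? ? ? ? ? ? ? /=; exact: cA.
Qed.

Lemma ex_floor (x : R) : exists m : int, m%:~R <= x < m%:~R + 1.
Proof.
exists (Num.floor x); have := floor_itv x.
by rewrite intrD.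
Qed.

(* At each level [h] between [y2] and [x2 + 1] the slices of [A] at levels [h]
   and [h - 1] contain abutting segments of total length 1. *)
Lemma standard_triangles_cover A : planar_convex A ->
  has_triangle A 1 1 0 0 1 -> has_triangle A (-1) 1 0 0 1 -> covers A.
Proof.
move=> cA [x1 [x2 [Ax Ax1 Ax2]]] [y1 [y2 [Ay Ay1 Ay2]]] X Y.
have {}Ax1 : A (x1 + 1, x2) by congr A: Ax1; congr pair; lra.
have {}Ax2 : A (x1, x2 + 1) by congr A: Ax2; congr pair; lra.
have {}Ay1 : A (y1 - 1, y2) by congr A: Ay1; congr pair; lra.
have {}Ay2 : A (y1, y2 - 1) by congr A: Ay2; congr pair; lra.
have [n /andP[n1 n2]] := ex_floor (Y - x2).
have [hy|hy] := lerP y2 (Y - n%:~R).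
  set d := x2 + 1 - y2; have d0 : 0 < d by rewrite /d; lra.
  set t := (Y - n%:~R - y2) / d.
  have t0 : 0 <= t by rewrite /t divr_ge0//; lra.
  have t1 : t <= 1 by rewrite /t ler_pdivrMr// /d; lra.
  have td : t * d = Y - n%:~R - y2 by rewrite /t mulfVK//; lra.
  have [m /andP[m1 m2]] := ex_floor (X - ((1 - t) * (y1 - 1) + t * x1)).
  have [c1|c1] := lerP (X - m%:~R) ((1 - t) * y1 + t * x1).
    exists m, n; apply: (@convex_hseg A ((1 - t) * (y1 - 1) + t * x1)
      ((1 - t) * y1 + t * x1) _ _ cA) => //; last lra.
    - apply: (convex_in (t := t) cA Ay1 Ax2) => //; rewrite /d in td; lra.
    - apply: (convex_in (t := t) cA Ay Ax2) => //; rewrite /d in td; lra.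
  exists m, (n + 1); rewrite intrD.
  apply: (@convex_hseg A ((1 - t) * y1 + t * x1)
    ((1 - t) * y1 + t * (x1 + 1)) _ _ cA) => //.
  - apply: (convex_in (t := t) cA Ay2 Ax) => //; rewrite /d in td; lra.
  - apply: (convex_in (t := t) cA Ay2 Ax1) => //; rewrite /d in td; lra.
  - lra.
  - lra.
set d := y2 - x2; have d0 : 0 < d by rewrite /d; lra.
set t := (Y - n%:~R - x2) / d.
have t0 : 0 <= t by rewrite /t divr_ge0//; lra.
have t1 : t <= 1 by rewrite /t ler_pdivrMr// /d; lra.
have td : t * d = Y - n%:~R - x2 by rewrite /t mulfVK//; lra.
have [m /andP[m1 m2]] := ex_floor (X - ((1 - t) * x1 + t * (y1 - 1))).
exists m, n; apply: (@convex_hseg A ((1 - t) * x1 + t * (y1 - 1))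
  ((1 - t) * (x1 + 1) + t * y1) _ _ cA) => //.
- apply: (convex_in (t := t) cA Ax Ay1) => //; rewrite /d in td; lra.
- apply: (convex_in (t := t) cA Ax1 Ay) => //; rewrite /d in td; lra.
- lra.
- lra.
Qed.

Definition in_basis A (u1 u2 v1 v2 : int) : set (R * R) :=
  [set p | A (p.1 * u1%:~R + p.2 * v1%:~R, p.1 * u2%:~R + p.2 * v2%:~R)].

Lemma in_basis_convex A u1 u2 v1 v2 :
  planar_convex A -> planar_convex (in_basis A u1 u2 v1 v2).
Proof.
move=> cA x y x' y' t Axy Axy' t0 t1; rewrite /in_basis /=.
by apply: (convex_in cA Axy Axy' t0 t1) => /=; ring.
Qed.

Lemma unimodularR u1 u2 v1 v2 : unimodular u1 u2 v1 v2 ->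
  (u1%:~R * v2%:~R - u2%:~R * v1%:~R) ^+ 2 = 1 :> R.
Proof. by move=> h; rewrite -!intrM -intrB -rmorphXn /= h. Qed.

(** Turns an identity valid only modulo [e = 1], with [e] a squared determinant in all uses, into a
    pure ring identity with cofactor [c]. *)
Lemma eq_mod1 (c e x y : R) : e = 1 -> x - y = c * (e - 1) -> x = y.
Proof. by move=> ->; rewrite subrr mulr0 => /subr0_eq. Qed.

Lemma in_basis_covers A u1 u2 v1 v2 : unimodular u1 u2 v1 v2 ->
  covers A <-> covers (in_basis A u1 u2 v1 v2).
Proof.
move=> uv; have uvR := unimodularR uv; split => cA x y.
  have [m [n Amn]] := cA (x * u1%:~R + y * v1%:~R) (x * u2%:~R + y * v2%:~R).
  exists ((u1 * v2 - u2 * v1) * (m * v2 - n * v1)),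
         ((u1 * v2 - u2 * v1) * (n * u1 - m * u2)).
  congr A: Amn; congr pair; rewrite /= !(intrM, intrB).
    by apply: (eq_mod1 (c := m%:~R) uvR); ring.
  by apply: (eq_mod1 (c := n%:~R) uvR); ring.
set d : R := u1%:~R * v2%:~R - u2%:~R * v1%:~R.
have [m [n Amn]] := cA (d * (x * v2%:~R - y * v1%:~R))
                       (d * (y * u1%:~R - x * u2%:~R)).
exists (m * u1 + n * v1), (m * u2 + n * v2).
congr A: Amn; congr pair; rewrite /= /d !(intrM, intrD).
  by apply: (eq_mod1 (c := x) uvR); ring.
by apply: (eq_mod1 (c := y) uvR); ring.
Qed.

Lemma in_basis_has_triangle A u1 u2 v1 v2 s a1 a2 b1 b2 :
  unimodular u1 u2 v1 v2 ->
  has_triangle (in_basis A u1 u2 v1 v2) s a1 a2 b1 b2 <->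
  has_triangle A s (a1 * u1 + a2 * v1) (a1 * u2 + a2 * v2)
                   (b1 * u1 + b2 * v1) (b1 * u2 + b2 * v2).
Proof.
move=> uv; have uvR := unimodularR uv; split => -[x [y [A0 A1 A2]]].
  exists (x * u1%:~R + y * v1%:~R), (x * u2%:~R + y * v2%:~R); split => //.
  - by congr A: A1; congr pair; rewrite /= !(intrM, intrD); ring.
  - by congr A: A2; congr pair; rewrite /= !(intrM, intrD); ring.
set d : R := u1%:~R * v2%:~R - u2%:~R * v1%:~R.
exists (d * (x * v2%:~R - y * v1%:~R)), (d * (y * u1%:~R - x * u2%:~R)).
split.
- congr A: A0; congr pair; rewrite /= /d.
    by apply: (eq_mod1 (c := - x) uvR); ring.
  by apply: (eq_mod1 (c := - y) uvR); ring.
- congr A: A1; congr pair; rewrite /= /d !(intrM, intrD).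
    by apply: (eq_mod1 (c := - x) uvR); ring.
  by apply: (eq_mod1 (c := - y) uvR); ring.
- congr A: A2; congr pair; rewrite /= /d !(intrM, intrD).
    by apply: (eq_mod1 (c := - x) uvR); ring.
  by apply: (eq_mod1 (c := - y) uvR); ring.
Qed.

Lemma triangles_cover A u1 u2 v1 v2 : planar_convex A ->
  unimodular u1 u2 v1 v2 ->
  has_triangle A 1 u1 u2 v1 v2 -> has_triangle A (-1) u1 u2 v1 v2 -> covers A.
Proof.
move=> cA uv tA tA'; apply/(in_basis_covers _ uv).
apply: standard_triangles_cover; first exact: in_basis_convex.
- by apply/(in_basis_has_triangle _ _ _ _ _ _ uv); rewrite !(mul1r, mul0r, addr0, add0r).
- by apply/(in_basis_has_triangle _ _ _ _ _ _ uv); rewrite !(mul1r, mul0r, addr0, add0r).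
Qed.

End Planar.

(** * Mixtures of lattice triangles *)

Definition mix {R : realType} (l : R) (A B : set (R * R)) : set (R * R) :=
  [set p | exists a b a' b', [/\ A (a, b), B (a', b') &
     p = (l * a + (1 - l) * a', l * b + (1 - l) * b')]].

(* The triangle is chosen before [A] and [B], so that the same one serves for
   [-A] and [-B]. *)
Definition fits {R : realType} (l : R) (u1 u2 v1 v2 p1 p2 q1 q2 : int) :=
  exists a1 a2 b1 b2 : int, unimodular a1 a2 b1 b2 /\
    forall A B : set (R * R), planar_convex A -> planar_convex B ->
      has_triangle A 1 u1 u2 v1 v2 -> has_triangle B 1 p1 p2 q1 q2 ->
      has_triangle (mix l A B) (3 / 4) a1 a2 b1 b2.

Section Mixtures.
Variable R : realType.
Implicit Types (A B : set (R * R)) (l : R).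

Lemma mix_in l A B a b a' b' x y : A (a, b) -> B (a', b') ->
  x = l * a + (1 - l) * a' -> y = l * b + (1 - l) * b' -> mix l A B (x, y).
Proof. by move=> Aab Bab -> ->; exists a, b, a', b'. Qed.

Lemma mix_convex l A B :
  planar_convex A -> planar_convex B -> planar_convex (mix l A B).
Proof.
move=> cA cB x y x' y' t [a [b [c [d [Aab Bcd [-> ->]]]]]]
  [a' [b' [c' [d' [Aab' Bcd' [-> ->]]]]]] t0 t1.
apply: (mix_in (cA _ _ _ _ _ Aab Aab' t0 t1) (cB _ _ _ _ _ Bcd Bcd' t0 t1)).
  ring.
ring.
Qed.

Lemma mixC l A B : mix (1 - l) A B = mix l B A.
Proof.
apply/seteqP; split => -[x y] [a [b [c [d [Aab Bcd [-> ->]]]]]];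
  by apply: (mix_in Bcd Aab); ring.
Qed.

Lemma mix_in_basis l A B u1 u2 v1 v2 :
  mix l (in_basis A u1 u2 v1 v2) (in_basis B u1 u2 v1 v2) `<=`
  in_basis (mix l A B) u1 u2 v1 v2.
Proof.
move=> p [a [b [c [d [+ + ->]]]]]; rewrite /in_basis /= => Aab Bcd.
by apply: (mix_in Aab Bcd); ring.
Qed.

Lemma has_triangle_swap A s u1 u2 v1 v2 :
  has_triangle A s u1 u2 v1 v2 -> has_triangle A s v1 v2 u1 u2.
Proof. by case=> x [y [A0 A1 A2]]; exists x, y. Qed.

(** The endpoint of [u] becomes the base vertex. Together with the swap this generates all six
    labellings, so that case analyses on edges need one representative only. *)
Lemma has_triangle_rot A s u1 u2 v1 v2 : has_triangle A s u1 u2 v1 v2 ->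
  has_triangle A s (v1 - u1) (v2 - u2) (- u1) (- u2).
Proof.
case=> x [y [A0 A1 A2]]; exists (x + s * u1%:~R), (y + s * u2%:~R); split=> //.
- by congr A: A2; congr pair; rewrite !intrB; ring.
- by congr A: A0; congr pair; rewrite !mulrNz; ring.
Qed.

Lemma fits_basis l u1 u2 v1 v2 p1 p2 q1 q2 : unimodular u1 u2 v1 v2 ->
  fits l 1 0 0 1 p1 p2 q1 q2 ->
  fits l u1 u2 v1 v2 (p1 * u1 + p2 * v1) (p1 * u2 + p2 * v2)
                     (q1 * u1 + q2 * v1) (q1 * u2 + q2 * v2).
Proof.
move=> uv [a1 [a2 [b1 [b2 [ab F]]]]].
exists (a1 * u1 + a2 * v1), (a1 * u2 + a2 * v2), (b1 * u1 + b2 * v1),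
  (b1 * u2 + b2 * v2); split.
  rewrite /unimodular -[RHS]mulr1 -{1}ab -uv; ring.
move=> A B cA cB tA tB.
apply/(in_basis_has_triangle _ _ _ _ _ _ uv).
have /F F' := in_basis_convex (u1 := u1) (u2 := u2) (v1 := v1) (v2 := v2) cA.
have {F'}/F' F' := in_basis_convex (u1 := u1) (u2 := u2) (v1 := v1) (v2 := v2) cB.
have [||x [y [M0 M1 M2]]] := F'.
- by apply/(in_basis_has_triangle _ _ _ _ _ _ uv);
    rewrite !(mul1r, mul0r, addr0, add0r).
- exact/(in_basis_has_triangle _ _ _ _ _ _ uv).
by exists x, y; split; exact: mix_in_basis.
Qed.

Lemma fitsC l u1 u2 v1 v2 p1 p2 q1 q2 :
  fits (1 - l) p1 p2 q1 q2 u1 u2 v1 v2 -> fits l u1 u2 v1 v2 p1 p2 q1 q2.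
Proof.
case=> a1 [a2 [b1 [b2 [ab F]]]]; exists a1, a2, b1, b2; split=> // A B *.
by rewrite -mixC; exact: F.
Qed.

Lemma fits_swapl l u1 u2 v1 v2 p1 p2 q1 q2 :
  fits l v1 v2 u1 u2 p1 p2 q1 q2 -> fits l u1 u2 v1 v2 p1 p2 q1 q2.
Proof.
case=> a1 [a2 [b1 [b2 [ab F]]]]; exists a1, a2, b1, b2; split=> // A B cA cB tA tB.
by apply: F => //; exact: has_triangle_swap.
Qed.

Lemma fits_rotl l u1 u2 v1 v2 p1 p2 q1 q2 :
  fits l (v1 - u1) (v2 - u2) (- u1) (- u2) p1 p2 q1 q2 ->
  fits l u1 u2 v1 v2 p1 p2 q1 q2.
Proof.
case=> a1 [a2 [b1 [b2 [ab F]]]]; exists a1, a2, b1, b2; split=> // A B cA cB tA tB.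
by apply: F => //; exact: has_triangle_rot.
Qed.

Lemma fits_swapr l u1 u2 v1 v2 p1 p2 q1 q2 :
  fits l u1 u2 v1 v2 q1 q2 p1 p2 -> fits l u1 u2 v1 v2 p1 p2 q1 q2.
Proof. by move=> F; apply/fitsC/fits_swapl/fitsC; rewrite subKr. Qed.

Lemma fits_rotr l u1 u2 v1 v2 p1 p2 q1 q2 :
  fits l u1 u2 v1 v2 (q1 - p1) (q2 - p2) (- p1) (- p2) ->
  fits l u1 u2 v1 v2 p1 p2 q1 q2.
Proof. by move=> F; apply/fitsC/fits_rotl/fitsC; rewrite subKr. Qed.

Lemma convex_in3 A x y x' y' x'' y'' a b X Y : planar_convex A ->
  A (x, y) -> A (x', y') -> A (x'', y'') -> 0 <= a -> 0 <= b -> a + b <= 1 ->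
  X = (1 - a - b) * x + a * x' + b * x'' ->
  Y = (1 - a - b) * y + a * y' + b * y'' -> A (X, Y).
Proof.
move=> cA A0 A1 A2 a0 b0 ab -> ->.
have [ab0|ab0] := eqVneq (a + b) 0.
  have -> : a = 0 by lra.
  have -> : b = 0 by lra.
  by congr A: A0; congr pair; ring.
have ab1 : 0 < a + b by rewrite lt_def ab0; lra.
have A3 := cA _ _ _ _ (b / (a + b)) A1 A2.
apply: (convex_in (t := a + b) cA A0 (A3 _ _)) => //.
- by rewrite divr_ge0//; lra.
- by rewrite ler_pdivrMr//; lra.
- by lra.
- by field.
- by field.
Qed.

(** A base [a, a + 3/4] inside a base of length 1 allows apexes in [0, 1/4] + (3/4) Z. The left-hand
    side runs over a segment of length (|n| + 1) / 4, at least the gap length 1/2 unless n = 0, when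
    the segment is [0, 1/4] itself. *)
Lemma shared_edge_shift (n : int) l : exists (k : int) (t r a : R),
  [/\ 0 <= t <= 1, 0 <= r <= 1 / 4, 0 <= a <= 1 / 4 &
   n%:~R * (3 / 4 - l) + n%:~R * t / 4 + r = a + 3 / 4 * k%:~R].
Proof.
have [k /andP[k1 k2]] := ex_floor (n%:~R * (3 / 4 - l) / (3 / 4)).
have [rho rhoE] : exists rho, n%:~R * (3 / 4 - l) = 3 / 4 * k%:~R + rho.
  by exists (n%:~R * (3 / 4 - l) - 3 / 4 * k%:~R); ring.
rewrite rhoE in k1 k2.
have rho0 : 0 <= rho by lra.
have rho1 : rho < 3 / 4 by lra.
have [r1|r1] := lerP rho (1 / 4).
  by exists k, 0, 0, rho; split; rewrite ?rhoE; lra.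
have [r2|r2] := lerP (1 / 2) rho.
  by exists (k + 1), 0, (3 / 4 - rho), 0; split; rewrite ?rhoE ?intrD; lra.
(* With [rho] strictly between 1/4 and 1/2, [r] alone cannot cross the gap: [t] moves the point down
   to 1/4 if n < 0, or up to 1/2 if n > 0, from where r = 1/4 reaches 3/4. *)
have [n0|n0|n0] := ltrgtP n 0.
- have n1 : n%:~R <= -1 :> R by rewrite (_ : -1 = (-1)%:~R)// ler_int; lia.
  exists k, ((rho - 1 / 4) * 4 / - n%:~R), 0, (1 / 4); split; try lra.
    rewrite divr_ge0 ?ler_pdivrMr /=; lra.
  rewrite rhoE; field; lra.
- have n1 : 1 <= n%:~R :> R by rewrite (_ : 1 = 1%:~R)// ler_int; lia.
  exists (k + 1), ((1 / 2 - rho) * 4 / n%:~R), (1 / 4), 0; split; try lra.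
    rewrite divr_ge0 ?ler_pdivrMr /=; lra.
  rewrite rhoE intrD; field; lra.
- by exists 0, 0, 0, 0; rewrite n0; split; lra.
Qed.

(** The common horizontal edges add up to a base of length l + (1 - l) = 1, and the apex is sought
    in the slice at height 3/4. *)
Lemma fits_shared_edge l n : 1 / 4 <= l -> l <= 3 / 4 ->
  fits l 1 0 0 1 1 0 n 1.
Proof.
move=> l1 l2; have [k [t [r [a [/andP[t0 t1] /andP[r0 r1] /andP[a0 a1] eqk]]]]] :=
  shared_edge_shift n l.
exists 1, 0, k, 1; split; first by rewrite /unimodular; ring.
move=> A B cA cB [x1 [x2 [Ax Ax1 Ax2]]] [y1 [y2 [By By1 By2]]].
have cM := mix_convex (l := l) cA cB.
set M := mix l A B in cM *.
pose c1 := l * x1 + (1 - l) * y1; pose c2 := l * x2 + (1 - l) * y2.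
have M0 : M (c1, c2) by apply: (mix_in Ax By).
have M1 : M (c1 + 1, c2) by apply: (mix_in Ax1 By1); rewrite /c1 /c2; ring.
have l0 : l != 0 by lra.
have l10 : 1 - l != 0 by lra.
(* Height 3/4 is split as l + (3/4 - l) here, using the apex of the first triangle, and as (1 - l) +
   (l - 1/4) in [Mr], using the apex of the second. In both cases [r <= 1/4] keeps the other point
   inside its triangle. *)
have Ml : M (c1 + n%:~R * (3 / 4 - l) + r, c2 + 3 / 4).
  have B3 := convex_in3 (a := r / (1 - l)) (b := (3 / 4 - l) / (1 - l)) cB By By1 By2.
  apply: (mix_in Ax2 (B3 _ _ _ _ _ erefl erefl)).
  - by rewrite divr_ge0//; lra.
  - by rewrite divr_ge0//; lra.
  - by rewrite -mulrDl ler_pdivrMr; lra.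
  - by rewrite /c1; field.
  - by rewrite /c2; field.
have Mr : M (c1 + n%:~R * (1 - l) + r, c2 + 3 / 4).
  have A3 := convex_in3 (a := r / l) (b := (l - 1 / 4) / l) cA Ax Ax1 Ax2.
  apply: (mix_in (A3 _ _ _ _ _ erefl erefl) By2).
  - by rewrite divr_ge0//; lra.
  - by rewrite divr_ge0//; lra.
  - by rewrite -mulrDl ler_pdivrMr; lra.
  - by rewrite /c1; field.
  - by rewrite /c2; field.
exists (c1 + a), c2; split.
- by apply: (convex_hseg cM M0 M1); lra.
- rewrite (_ : c2 + _ = c2); last by ring.
  by apply: (convex_hseg cM M0 M1); lra.
- by apply: (convex_in (t := t) cM Ml Mr) => //; lra.
Qed.

(** Since l >= 1/2, the intervals [0, l] + (3/4) Z leave gaps of length at most 1/4, and the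
    admissible range [lo, up - 3/4] is at least that long. *)
Lemma far_edge_shift l lo up : 1 / 2 <= l -> 1 <= up - lo ->
  exists (k : int) (a : R),
    [/\ 0 <= a <= l, lo <= a + 3 / 4 * k%:~R & a + 3 / 4 * k%:~R + 3 / 4 <= up].
Proof.
move=> l1 lu; have [k /andP[k1 k2]] := ex_floor (lo / (3 / 4)).
have [r|r] := lerP (lo - 3 / 4 * k%:~R) (1 / 2).
  by exists k, (lo - 3 / 4 * k%:~R); split; lra.
by exists (k + 1), 0; rewrite intrD; split; lra.
Qed.

(** A long edge does the work of the whole second triangle; dropping the rest leaves any of its
    three edges, in either direction, available. *)
Definition fits_segment l (u1 u2 v1 v2 s1 s2 : int) :=
  exists a1 a2 b1 b2 : int, unimodular a1 a2 b1 b2 /\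
    forall A B, planar_convex A -> planar_convex B ->
      has_triangle A 1 u1 u2 v1 v2 ->
      (exists x y, B (x, y) /\ B (x + s1%:~R, y + s2%:~R)) ->
      has_triangle (mix l A B) (3 / 4) a1 a2 b1 b2.

(** The new triangle has one vertex on the vertical edge of length [l] in the mixture and its own
    vertical edge, of length 3/4, at horizontal distance 3/4. The slice there has length at least 1,
    which leaves room for the lattice condition. *)
Lemma fits_far_edge_le l s1 s2 : 1 / 2 <= l -> l <= 3 / 4 ->
  2 <= s1 -> s1 <= s2 -> fits_segment l 1 0 0 1 s1 s2.
Proof.
move=> l1 l2 s1_ge2 s12.
have S1 : 2 <= s1%:~R :> R by rewrite (_ : 2 = 2%:~R)// ler_int.
have S2 : s1%:~R <= s2%:~R :> R by rewrite ler_int.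
set S : R := s1%:~R in S1 S2; set T : R := s2%:~R in S2.
(* The lower point at abscissa 3/4 starts from the vertex (1, 0) and follows the segment. The upper
   one starts from (0, 1); if the whole segment does not reach abscissa 3/4, the rest is made up
   along the edge of slope -1. *)
pose lo : R := (3 / 4 - l) * T / S.
pose up : R := if 3 / 4 <= (1 - l) * S then l + 3 / 4 * T / S
               else l + (1 - l) * T - (3 / 4 - (1 - l) * S).
have TS : 1 <= T / S by rewrite ler_pdivlMr; lra.
have SK : T / S * S = T by rewrite mulfVK//; lra.
(* In the first case the length is l + l T / S >= 2 l. In the second it is at least 2 l - 3/2 + 2 (1
   - l) S >= 5/2 - 2 l, because S >= 2; this is at least 1 as l <= 3/4. *)
have lu : 1 <= up - lo.
  rewrite /up /lo -![_ * T / S]mulrA; case: ifPn => [c|]; first nra.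
  rewrite -ltNge => c; nra.
have [k [a [/andP[a0 a1] loa aup]]] := far_edge_shift l1 lu.
exists 1, k, 1, (k + 1); split; first by rewrite /unimodular; ring.
move=> A B cA cB [x1 [x2 [Ax Ax1 Ax2]]] [y1 [y2 [By Bs]]].
have cM := mix_convex (l := l) cA cB.
set M := mix l A B in cM *.
pose c1 := l * x1 + (1 - l) * y1; pose c2 := l * x2 + (1 - l) * y2.
have l10 : 1 - l != 0 by lra.
have S0 : S != 0 by lra.
have M0 : M (c1, c2) by apply: (mix_in Ax By).
have M1 : M (c1, c2 + l) by apply: (mix_in Ax2 By); rewrite /c1 /c2; ring.
have lS : 3 / 4 - l <= (1 - l) * S by nra.
have Mlo : M (c1 + 3 / 4, c2 + lo).
  have B3 := convex_in (t := (3 / 4 - l) / ((1 - l) * S)) cB By Bs.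
  apply: (mix_in Ax1 (B3 _ _ _ _ erefl erefl)).
  - by rewrite divr_ge0//; nra.
  - by rewrite ler_pdivrMr; nra.
  - by rewrite /c1 -/S; field; rewrite S0.
  - by rewrite /c2 /lo -/T; field; rewrite S0.
have Mup : M (c1 + 3 / 4, c2 + up).
  rewrite /up; case: ifPn => [c|].
    have B3 := convex_in (t := (3 / 4) / ((1 - l) * S)) cB By Bs.
    apply: (mix_in Ax2 (B3 _ _ _ _ erefl erefl)).
    - by rewrite divr_ge0//; nra.
    - by rewrite ler_pdivrMr; nra.
    - by rewrite /c1 -/S; field; rewrite S0.
    - by rewrite /c2 -/T; field; rewrite S0.
  rewrite -ltNge => c.
  have A3 := convex_in (t := (3 / 4 - (1 - l) * S) / l) cA Ax2 Ax1.
  apply: (mix_in (A3 _ _ _ _ erefl erefl) Bs).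
  - by rewrite divr_ge0//; lra.
  - by rewrite ler_pdivrMr; nra.
  - by rewrite /c1 -/S; field; lra.
  - by rewrite /c2 -/T; field; lra.
exists c1, (c2 + a); split.
- by apply: (convex_vseg cM M0 M1); lra.
- rewrite (_ : c1 + _ = c1 + 3 / 4); last by ring.
  by apply: (convex_vseg cM Mlo Mup); lra.
- rewrite (_ : c1 + _ = c1 + 3 / 4); last by ring.
  by rewrite intrD; apply: (convex_vseg cM Mlo Mup); lra.
Qed.

End Mixtures.

Section Three_quarters.
Variable R : realType.
Implicit Types (A B : set (R * R)) (l : R).

Lemma fits_basis_eq l u1 u2 v1 v2 p1 p2 q1 q2 p1' p2' q1' q2' :
  unimodular u1 u2 v1 v2 -> fits l 1 0 0 1 p1 p2 q1 q2 ->
  p1' = p1 * u1 + p2 * v1 -> p2' = p1 * u2 + p2 * v2 ->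
  q1' = q1 * u1 + q2 * v1 -> q2' = q1 * u2 + q2 * v2 ->
  fits l u1 u2 v1 v2 p1' p2' q1' q2'.
Proof. by move=> uv F -> -> -> ->; exact: fits_basis. Qed.

Lemma fits_segment_basis l u1 u2 v1 v2 s1 s2 s1' s2' : unimodular u1 u2 v1 v2 ->
  fits_segment l 1 0 0 1 s1 s2 ->
  s1' = s1 * u1 + s2 * v1 -> s2' = s1 * u2 + s2 * v2 ->
  fits_segment l u1 u2 v1 v2 s1' s2'.
Proof.
move=> uv [a1 [a2 [b1 [b2 [ab F]]]]] -> ->.
exists (a1 * u1 + a2 * v1), (a1 * u2 + a2 * v2), (b1 * u1 + b2 * v1),
  (b1 * u2 + b2 * v2); split.
  rewrite /unimodular -[RHS]mulr1 -{1}ab -uv; ring.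
move=> A B cA cB tA [x [y [B0 B1]]].
apply/(in_basis_has_triangle _ _ _ _ _ _ uv).
have /F F' := in_basis_convex (u1 := u1) (u2 := u2) (v1 := v1) (v2 := v2) cA.
have {F'}/F' F' := in_basis_convex (u1 := u1) (u2 := u2) (v1 := v1) (v2 := v2) cB.
have uvR := unimodularR R uv.
pose d : R := u1%:~R * v2%:~R - u2%:~R * v1%:~R.
have [||x' [y' [M0 M1 M2]]] := F'.
- by apply/(in_basis_has_triangle _ _ _ _ _ _ uv);
    rewrite !(mul1r, mul0r, addr0, add0r).
- exists (d * (x * v2%:~R - y * v1%:~R)), (d * (y * u1%:~R - x * u2%:~R)).
  rewrite /in_basis /=; split.
    congr B: B0; congr pair; rewrite /d.
      by apply: (eq_mod1 (c := - x) uvR); ring.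
    by apply: (eq_mod1 (c := - y) uvR); ring.
  congr B: B1; congr pair; rewrite /d !(intrD, intrM).
    by apply: (eq_mod1 (c := - x) uvR); ring.
  by apply: (eq_mod1 (c := - y) uvR); ring.
by exists x', y'; split; exact: mix_in_basis.
Qed.

Lemma fits_segment_swap l u1 u2 v1 v2 s1 s2 :
  fits_segment l v1 v2 u1 u2 s1 s2 -> fits_segment l u1 u2 v1 v2 s1 s2.
Proof.
case=> a1 [a2 [b1 [b2 [ab F]]]]; exists a1, a2, b1, b2; split=> // A B cA cB tA tB.
by apply: F => //; exact: has_triangle_swap.
Qed.

Lemma fits_segment_rot l u1 u2 v1 v2 s1 s2 :
  fits_segment l (v1 - u1) (v2 - u2) (- u1) (- u2) s1 s2 ->
  fits_segment l u1 u2 v1 v2 s1 s2.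
Proof.
case=> a1 [a2 [b1 [b2 [ab F]]]]; exists a1, a2, b1, b2; split=> // A B cA cB tA tB.
by apply: F => //; exact: has_triangle_rot.
Qed.

Lemma fits_segmentN l u1 u2 v1 v2 s1 s2 :
  fits_segment l u1 u2 v1 v2 (- s1) (- s2) -> fits_segment l u1 u2 v1 v2 s1 s2.
Proof.
case=> a1 [a2 [b1 [b2 [ab F]]]]; exists a1, a2, b1, b2; split=> // A B cA cB tA.
case=> x [y [B0 B1]]; apply: F => //.
exists (x + s1%:~R), (y + s2%:~R); split=> //.
by congr B: B0; congr pair; rewrite mulrNz addrK.
Qed.

Lemma fits_far_edge_pos l s1 s2 : 1 / 2 <= l -> l <= 3 / 4 ->
  2 <= s1 -> 2 <= s2 -> fits_segment l 1 0 0 1 s1 s2.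
Proof.
move=> l1 l2 s1_ge2 s2_ge2; have [s12|s21] := lerP s1 s2.
  exact: fits_far_edge_le.
apply: fits_segment_swap.
by apply: (fits_segment_basis _ (fits_far_edge_le l1 l2 s2_ge2 (ltW s21))) => //; lia.
Qed.

Lemma fits_far_edge_mixed l s1 s2 : 1 / 2 <= l -> l <= 3 / 4 ->
  s2 <= -2 -> 2 <= s1 + s2 -> fits_segment l 1 0 0 1 s1 s2.
Proof.
move=> l1 l2 s2n s12; have s2p : 2 <= - s2 by lia.
apply/fits_segmentN/fits_segment_rot/fits_segment_swap.
apply: (fits_segment_basis _ (fits_far_edge_pos l1 l2 s12 s2p)) => //; lia.
Qed.

(** The numbers [s1], [s2], [- (s1 + s2)] sum to zero, so two of them have the same sign; a symmetry
    of the standard triangle, which permutes them up to a common sign, makes these two the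
    coordinates. *)
Lemma fits_far_edge l s1 s2 : 1 / 2 <= l -> l <= 3 / 4 ->
  2 <= `|s1| -> 2 <= `|s2| -> 2 <= `|s1 + s2| -> fits_segment l 1 0 0 1 s1 s2.
Proof.
move=> l1 l2.
have pos t1 t2 : 2 <= t1 -> 2 <= `|t2| -> 2 <= `|t1 + t2| ->
    fits_segment l 1 0 0 1 t1 t2.
  move=> t1p t2p t12.
  have [t2p'|t2n] := lerP 2 t2; first exact: fits_far_edge_pos.
  have [t12p|t12n] := lerP 2 (t1 + t2).
    by apply: fits_far_edge_mixed => //; lia.
  have F : fits_segment l 1 0 0 1 (- t2) (- t1).
    by apply: fits_far_edge_mixed => //; lia.
  apply/fits_segmentN/fits_segment_swap.
  by apply: (fits_segment_basis _ F) => //; lia.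
move=> s1n s2n s12n; have [s1p|s1p] := lerP 2 s1; first exact: pos.
by apply: fits_segmentN; apply: pos; lia.
Qed.

Lemma fits_from_segment l p1 p2 q1 q2 u1 u2 v1 v2 :
  [\/ fits_segment l u1 u2 v1 v2 p1 p2, fits_segment l u1 u2 v1 v2 q1 q2 |
      fits_segment l u1 u2 v1 v2 (q1 - p1) (q2 - p2)] ->
  fits l u1 u2 v1 v2 p1 p2 q1 q2.
Proof.
case=> -[a1 [a2 [b1 [b2 [ab F]]]]]; exists a1, a2, b1, b2; split=> // A B cA cB tA
  [x [y [B0 B1 B2]]]; apply: F => //.
- by exists x, y; rewrite -[p1%:~R]mul1r -[p2%:~R]mul1r.
- by exists x, y; rewrite -[q1%:~R]mul1r -[q2%:~R]mul1r.
- exists (x + 1 * p1%:~R), (y + 1 * p2%:~R); split=> //.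
  by congr B: B2; congr pair; rewrite intrB; ring.
Qed.

Definition same_sign (a b : int) := (0 < a /\ 0 < b) \/ (a < 0 /\ b < 0).

(* Sign patterns [(+,+)] and [(+,-)] together would make the determinant at
   least 2 in absolute value. *)
Lemma same_sign_unimodular (a b c d : int) : unimodular a b c d ->
  c != 0 -> d != 0 -> same_sign a b -> same_sign c d.
Proof.
rewrite /unimodular /same_sign => /eqP; rewrite sqrf_eq1 => D c0 d0 ab.
have {}D : a * d - b * c = 1 \/ a * d - b * c = -1.
  by case/orP: D => /eqP; [left|right].
have [c1|c1] : 0 < c \/ c < 0 by lia.
  have [d1|d1] : 0 < d \/ d < 0 by lia.
    by left.
  by exfalso; case: ab => -[a1 b1]; case: D; nia.
have [d1|d1] : 0 < d \/ d < 0 by lia.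
  by exfalso; case: ab => -[a1 b1]; case: D; nia.
by right.
Qed.

(** The three numbers are, up to sign, the determinants of (a, b) with the three edges of the
    standard triangle; hence the invariance under its symmetries. *)
Definition long_edge (a b : int) := [&& 2 <= `|a|, 2 <= `|b| & 2 <= `|a + b|].

(* All three edges having the pattern of [p] up to sign, one of them is the sum
   of the two others with all signs equal. *)
Lemma long_edge_signed (p1 p2 q1 q2 : int) : unimodular p1 p2 q1 q2 ->
  q1 != 0 -> q2 != 0 -> q1 - p1 != 0 -> q2 - p2 != 0 -> same_sign p1 p2 ->
  [|| long_edge p1 p2, long_edge q1 q2 | long_edge (q1 - p1) (q2 - p2)].
Proof.
move=> D q10 q20 e10 e20 ps.
have qs := same_sign_unimodular D q10 q20 ps.
have D' : unimodular p1 p2 (q1 - p1) (q2 - p2).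
  by rewrite /unimodular -D; ring.
have es := same_sign_unimodular D' e10 e20 ps.
rewrite /long_edge; rewrite /same_sign in ps qs es; lia.
Qed.

Lemma long_edgeC (a b : int) : long_edge b a = long_edge a b.
Proof. by rewrite /long_edge addrC andbCA. Qed.

Lemma long_edge_coord3 (a b : int) : long_edge a (- (a + b)) = long_edge a b.
Proof.
rewrite /long_edge (_ : a + - (a + b) = - b); last by ring.
by rewrite !normrN [X in _ && X]andbC.
Qed.

(** The nine inequations say that the two triangles have no common edge direction. Two of the three
    coordinates of [p], with [- (p1 + p2)] as third, agree in sign, and [long_edge_signed] applies
    to these two. *)
Lemma exists_long_edge (p1 p2 q1 q2 : int) : unimodular p1 p2 q1 q2 ->
  p1 != 0 -> p2 != 0 -> p1 + p2 != 0 -> q1 != 0 -> q2 != 0 -> q1 + q2 != 0 ->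
  q1 - p1 != 0 -> q2 - p2 != 0 -> q1 + q2 - (p1 + p2) != 0 ->
  [|| long_edge p1 p2, long_edge q1 q2 | long_edge (q1 - p1) (q2 - p2)].
Proof.
move=> D p10 p20 p30 q10 q20 q30 e10 e20 e30.
have [s12|[s13|s23]] : same_sign p1 p2 \/
    same_sign p1 (- (p1 + p2)) \/ same_sign p2 (- (p1 + p2)).
  rewrite /same_sign; lia.
- exact: long_edge_signed.
- have D' : unimodular p1 (- (p1 + p2)) q1 (- (q1 + q2)).
    by rewrite /unimodular -D; ring.
  have := long_edge_signed D' q10 _ e10 _ s13.
  rewrite (_ : - (q1 + q2) - - (p1 + p2) = - ((q1 - p1) + (q2 - p2))); last by ring.
  by rewrite !long_edge_coord3; apply; lia.
- have D' : unimodular p2 (- (p1 + p2)) q2 (- (q1 + q2)).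
    by rewrite /unimodular -D; ring.
  have := long_edge_signed D' q20 _ e20 _ s23.
  rewrite (_ : - (q1 + q2) - - (p1 + p2) = - ((q2 - p2) + (q1 - p1))); last by ring.
  rewrite ![p1 + p2]addrC ![q1 + q2]addrC !long_edge_coord3.
  by rewrite !(long_edgeC _ p1, long_edgeC _ q1, long_edgeC _ (q1 - p1)); apply; lia.
Qed.

Lemma fits_no_shared_edge_half l (p1 p2 q1 q2 : int) :
  1 / 2 <= l -> l <= 3 / 4 -> unimodular p1 p2 q1 q2 ->
  p1 != 0 -> p2 != 0 -> p1 + p2 != 0 -> q1 != 0 -> q2 != 0 -> q1 + q2 != 0 ->
  q1 - p1 != 0 -> q2 - p2 != 0 -> q1 + q2 - (p1 + p2) != 0 ->
  fits l 1 0 0 1 p1 p2 q1 q2.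
Proof.
move=> l1 l2 D p10 p20 p30 q10 q20 q30 e10 e20 e30.
apply: fits_from_segment.
have := exists_long_edge D p10 p20 p30 q10 q20 q30 e10 e20 e30.
case/or3P => /and3P[? ? ?]; [constructor 1|constructor 2|constructor 3];
  exact: fits_far_edge.
Qed.

(** For l < 1/2 the triangles exchange roles: the standard one is written in the basis (p, q), and
    the inverse matrix satisfies the same nine inequations up to sign. *)
Lemma fits_no_shared_edge l (p1 p2 q1 q2 : int) :
  1 / 4 <= l -> l <= 3 / 4 -> unimodular p1 p2 q1 q2 ->
  p1 != 0 -> p2 != 0 -> p1 + p2 != 0 -> q1 != 0 -> q2 != 0 -> q1 + q2 != 0 ->
  q1 - p1 != 0 -> q2 - p2 != 0 -> q1 + q2 - (p1 + p2) != 0 ->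
  fits l 1 0 0 1 p1 p2 q1 q2.
Proof.
move=> l1 l2 D p10 p20 p30 q10 q20 q30 e10 e20 e30.
have [lh|lh] := lerP (1 / 2) l; first exact: fits_no_shared_edge_half.
have /orP D1 : (p1 * q2 - p2 * q1 == 1) || (p1 * q2 - p2 * q1 == -1).
  by rewrite -sqrf_eq1; apply/eqP.
apply: fitsC; case: D1 => /eqP D1.
- have F : fits (1 - l) 1 0 0 1 q2 (- p2) (- q1) p1.
    apply: fits_no_shared_edge_half; try lra; try lia.
    by rewrite /unimodular -D; ring.
  by apply: (fits_basis_eq D F); lia.
- have F : fits (1 - l) 1 0 0 1 (- q2) p2 q1 (- p1).
    apply: fits_no_shared_edge_half; try lra; try lia.
    by rewrite /unimodular -D; ring.
  by apply: (fits_basis_eq D F); lia.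
Qed.

Definition fits_upto_sign l (p1 p2 q1 q2 : int) :=
  fits l 1 0 0 1 p1 p2 q1 q2 \/ fits l 1 0 0 1 (- p1) (- p2) (- q1) (- q2).

Lemma upto_sign_swap l p1 p2 q1 q2 :
  fits_upto_sign l q1 q2 p1 p2 -> fits_upto_sign l p1 p2 q1 q2.
Proof. by case=> F; [left|right]; exact: fits_swapr. Qed.

Lemma upto_sign_rot l p1 p2 q1 q2 :
  fits_upto_sign l (q1 - p1) (q2 - p2) (- p1) (- p2) ->
  fits_upto_sign l p1 p2 q1 q2.
Proof.
case=> F; [left|right]; apply: fits_rotr => //.
have e (a b : int) : - b - - a = - (b - a) by ring.
by rewrite !e.
Qed.

Lemma upto_sign_swap_coord l p1 p2 q1 q2 :
  fits_upto_sign l p2 p1 q2 q1 -> fits_upto_sign l p1 p2 q1 q2.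
Proof.
by case=> F; [left|right]; apply: fits_swapl; apply: (fits_basis_eq _ F) => //; lia.
Qed.

Lemma upto_sign_rot_coord l p1 p2 q1 q2 :
  fits_upto_sign l p2 (- p1 - p2) q2 (- q1 - q2) -> fits_upto_sign l p1 p2 q1 q2.
Proof.
by case=> F; [left|right]; apply: fits_rotl; apply: (fits_basis_eq _ F) => //; lia.
Qed.

(** Here p = (±1, 0) and q2 = ±1. Relabelling vertices corrects the sign of [p1]; the sign of [q2],
    the side of the common edge on which the second triangle lies, is what the reflection is for. *)
Lemma upto_sign_shared_p2 l p1 p2 q1 q2 : 1 / 4 <= l -> l <= 3 / 4 ->
  unimodular p1 p2 q1 q2 -> p2 = 0 -> fits_upto_sign l p1 p2 q1 q2.
Proof.
move=> l1 l2 + p20; rewrite /unimodular p20 mul0r subr0 => /eqP.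
have main (a b : int) : a = 1 \/ a = -1 -> fits l 1 0 0 1 a 0 b 1.
  case=> ->; first exact: fits_shared_edge.
  apply/fits_rotr/fits_swapr; rewrite oppr0 subr0 !opprK.
  exact: fits_shared_edge.
rewrite sqrf_eq1 => pq.
have : (`|p1| * `|q2| == 1)%N by rewrite -abszM; case/orP: pq => /eqP ->.
rewrite muln_eq1 => /andP[/eqP p1E /eqP q2E'].
have [q2E|q2E] : q2 = 1 \/ q2 = -1 by lia.
  by left; rewrite q2E; apply: main; lia.
by right; rewrite q2E oppr0 opprK; apply: main; lia.
Qed.

Lemma upto_sign_shared_coord2 l p1 p2 q1 q2 : 1 / 4 <= l -> l <= 3 / 4 ->
  unimodular p1 p2 q1 q2 -> [|| p2 == 0, q2 == 0 | q2 - p2 == 0] ->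
  fits_upto_sign l p1 p2 q1 q2.
Proof.
move=> l1 l2 D /or3P[/eqP z|/eqP z|/eqP z].
- exact: upto_sign_shared_p2.
- apply: upto_sign_swap; apply: upto_sign_shared_p2 => //.
  by rewrite /unimodular -D; ring.
- apply: upto_sign_rot; apply: upto_sign_shared_p2 => //.
  by rewrite /unimodular -D; ring.
Qed.

Lemma fits_upto_signP l p1 p2 q1 q2 : 1 / 4 <= l -> l <= 3 / 4 ->
  unimodular p1 p2 q1 q2 -> fits_upto_sign l p1 p2 q1 q2.
Proof.
move=> l1 l2 D.
have [z|nz2] := boolP [|| p2 == 0, q2 == 0 | q2 - p2 == 0].
  exact: upto_sign_shared_coord2.
have [z|nz1] := boolP [|| p1 == 0, q1 == 0 | q1 - p1 == 0].
  apply: upto_sign_swap_coord; apply: upto_sign_shared_coord2 => //.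
  by rewrite /unimodular -D; ring.
have [z|nz3] := boolP [|| p1 + p2 == 0, q1 + q2 == 0 | q1 + q2 - (p1 + p2) == 0].
  apply: upto_sign_rot_coord; apply: upto_sign_shared_coord2 => //.
    by rewrite /unimodular -D; ring.
  lia.
by left; apply: fits_no_shared_edge => //; lia.
Qed.

(** The first triangle, shrunk by 3 / (4 l) towards a vertex, is combined with a single point of
    [B]. *)
Lemma fits_large l u1 u2 v1 v2 p1 p2 q1 q2 : 3 / 4 <= l -> l <= 1 ->
  unimodular u1 u2 v1 v2 -> fits l u1 u2 v1 v2 p1 p2 q1 q2.
Proof.
move=> l1 l2 D; exists u1, u2, v1, v2; split=> // A B cA cB.
case=> [x [y [A0 A1 A2]]] [x' [y' [B0 _ _]]].
have l0 : l != 0 by lra.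
have t0 : 0 <= 3 / 4 / l by rewrite divr_ge0//; lra.
have t1 : 3 / 4 / l <= 1 by rewrite ler_pdivrMr; lra.
exists (l * x + (1 - l) * x'), (l * y + (1 - l) * y'); split.
- exact: (mix_in A0 B0).
- by apply: (mix_in (cA _ _ _ _ _ A0 A1 t0 t1) B0); field.
- by apply: (mix_in (cA _ _ _ _ _ A0 A2 t0 t1) B0); field.
Qed.

Lemma fits_or_opposite l u1 u2 v1 v2 p1 p2 q1 q2 : 0 <= l -> l <= 1 ->
  unimodular u1 u2 v1 v2 -> unimodular p1 p2 q1 q2 ->
  fits l u1 u2 v1 v2 p1 p2 q1 q2 \/
  fits l u1 u2 v1 v2 (- p1) (- p2) (- q1) (- q2).
Proof.
move=> l0 l1 U P.
have [lb|lb] := lerP (3 / 4) l; first by left; exact: fits_large.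
have [ls|ls] := lerP l (1 / 4).
  by left; apply: fitsC; apply: fits_large => //; lra.
set d := u1 * v2 - u2 * v1.
have dd : d ^+ 2 = 1 := U.
have D : unimodular (d * (p1 * v2 - p2 * v1)) (d * (p2 * u1 - p1 * u2))
    (d * (q1 * v2 - q2 * v1)) (d * (q2 * u1 - q1 * u2)).
  rewrite /unimodular.
  transitivity ((d ^+ 2) ^+ 3 * (p1 * q2 - p2 * q1) ^+ 2).
    by rewrite /d; ring.
  by rewrite dd P.
have back x1 x2 : x1 = d * (x1 * v2 - x2 * v1) * u1 + d * (x2 * u1 - x1 * u2) * v1
    /\ x2 = d * (x1 * v2 - x2 * v1) * u2 + d * (x2 * u1 - x1 * u2) * v2.
  by split; rewrite -[LHS]mulr1 -dd /d; ring.
have [bp1 bp2] := back p1 p2; have [bq1 bq2] := back q1 q2.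
case: (fits_upto_signP (ltW ls) (ltW lb) D) => F; [left|right].
  exact: (fits_basis_eq U F).
by apply: (fits_basis_eq U F); rewrite !mulNr -opprD; congr (- _).
Qed.

Lemma has_triangleN A s u1 u2 v1 v2 : has_triangle A (- s) u1 u2 v1 v2 <->
  has_triangle A s (- u1) (- u2) (- v1) (- v2).
Proof.
by split => -[x [y [A0 A1 A2]]]; exists x, y; split=> //;
  [congr A: A1|congr A: A2|congr A: A1|congr A: A2]; congr pair;
  rewrite !mulrNz; ring.
Qed.

Definition opp_set A : set (R * R) := [set p | A (- p.1, - p.2)].

Lemma opp_set_convex A : planar_convex A -> planar_convex (opp_set A).
Proof.
move=> cA x y x' y' t Ax Ax' t0 t1; rewrite /opp_set /=.
by apply: (convex_in cA Ax Ax' t0 t1) => /=; ring.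
Qed.

Lemma opp_set_triangle A s u1 u2 v1 v2 :
  has_triangle (opp_set A) s u1 u2 v1 v2 <-> has_triangle A (- s) u1 u2 v1 v2.
Proof.
by split => -[x [y [A0 A1 A2]]]; exists (- x), (- y); split;
  rewrite /opp_set /= in A0 A1 A2 *; rewrite ?opprK //;
  [congr A: A1|congr A: A2|congr A: A1|congr A: A2]; congr pair; ring.
Qed.

Lemma opp_set_mix l A B : mix l (opp_set A) (opp_set B) = opp_set (mix l A B).
Proof.
apply/seteqP; split => -[x y] [a [b [c [d [Aab Bcd]]]]].
  case=> -> ->; rewrite /opp_set /= in Aab Bcd *.
  by apply: (mix_in Aab Bcd); ring.
case=> /= xE yE; exists (- a), (- b), (- c), (- d).
by rewrite /opp_set /= !opprK; split=> //; congr pair; lra.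
Qed.

Lemma fits_both l u1 u2 v1 v2 p1 p2 q1 q2 A B :
  planar_convex A -> planar_convex B -> fits l u1 u2 v1 v2 p1 p2 q1 q2 ->
  has_triangle A 1 u1 u2 v1 v2 -> has_triangle A (-1) u1 u2 v1 v2 ->
  has_triangle B 1 p1 p2 q1 q2 -> has_triangle B (-1) p1 p2 q1 q2 ->
  exists a1 a2 b1 b2, [/\ unimodular a1 a2 b1 b2,
    has_triangle (mix l A B) (3 / 4) a1 a2 b1 b2 &
    has_triangle (mix l A B) (- (3 / 4)) a1 a2 b1 b2].
Proof.
move=> cA cB [a1 [a2 [b1 [b2 [ab F]]]]] tA tA' tB tB'.
exists a1, a2, b1, b2; split=> //; first exact: F.
by apply/opp_set_triangle; rewrite -opp_set_mix; apply: F;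
  [exact: opp_set_convex|exact: opp_set_convex|exact/opp_set_triangle..].
Qed.

Lemma mix_three_quarters l A B u1 u2 v1 v2 p1 p2 q1 q2 : 0 <= l -> l <= 1 ->
  planar_convex A -> planar_convex B ->
  unimodular u1 u2 v1 v2 -> unimodular p1 p2 q1 q2 ->
  has_triangle A 1 u1 u2 v1 v2 -> has_triangle A (-1) u1 u2 v1 v2 ->
  has_triangle B 1 p1 p2 q1 q2 -> has_triangle B (-1) p1 p2 q1 q2 ->
  exists a1 a2 b1 b2, [/\ unimodular a1 a2 b1 b2,
    has_triangle (mix l A B) (3 / 4) a1 a2 b1 b2 &
    has_triangle (mix l A B) (- (3 / 4)) a1 a2 b1 b2].
Proof.
move=> l0 l1 cA cB U P tA tA' tB tB'.
case: (fits_or_opposite l0 l1 U P) => F.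
  exact: (fits_both cA cB F tA tA' tB tB').
apply: (fits_both cA cB F tA tA'); first exact/has_triangleN.
by apply/has_triangleN; rewrite !opprK.
Qed.

End Three_quarters.

(** * Triangles inscribed in a covering body *)

Section Lattice_compactness.
Variable R : realType.
Implicit Types (A B E : set (R * R)).

Definition lattice_subset E :=
  forall p, E p -> exists m n : int, p = (m%:~R, n%:~R).

Lemma int_close (m n : int) (a : R) :
  `|a - m%:~R| < 1 / 4 -> `|a - n%:~R| < 1 / 4 -> m = n.
Proof.
move=> am an; have : `|(m - n)%:~R| < 1 :> R.
  rewrite intrB; move: am an; rewrite !ltr_norml; lra.
by rewrite -intr_norm (_ : 1 = 1%:~R)// ltr_int; lia.
Qed.

Lemma lattice_subset_closed E : lattice_subset E -> closed E.
Proof.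
move=> lE [a b] clE.
have close e : 0 < e -> exists m n : int,
    [/\ E (m%:~R, n%:~R), `|a - m%:~R| < e & `|b - n%:~R| < e].
  move=> e0; have [p [Ep]] := clE _ (nbhsx_ballx (a, b) _ e0).
  by have [m [n pE]] := lE p Ep; rewrite pE in Ep * => -[/= ? ?]; exists m, n.
have e4 : 0 < 1 / 4 :> R by lra.
have [m [n [Emn am bn]]] := close _ e4.
have [am0|am0] := eqVneq a m%:~R; last first.
  have am1 : 0 < `|a - m%:~R| by rewrite normr_gt0 subr_eq0.
  have [m' [n' [Emn' am' bn']]] := close _ am1.
  by have := int_close am (lt_trans am' am) => mm'; rewrite mm' ltxx in am'.
have [bn0|bn0] := eqVneq b n%:~R; first by rewrite am0 bn0.
have bn1 : 0 < `|b - n%:~R| by rewrite normr_gt0 subr_eq0.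
have [m' [n' [Emn' am' bn']]] := close _ bn1.
by have := int_close bn (lt_trans bn' bn) => nn'; rewrite nn' ltxx in bn'.
Qed.

Lemma closed_itv_ends (S : set R) (a b : R) : closed S -> a < b ->
  (forall h, a < h -> h < b -> S h) -> S a /\ S b.
Proof.
move=> cS ab hS; split; apply: cS => U /nbhs_ballP[e /= e0 eU].
- pose d := Num.min e (b - a) / 2.
  have d0 : 0 < d by rewrite divr_gt0// lt_min e0 subr_gt0.
  have de : d < e by rewrite ltr_pdivrMr// (@le_lt_trans _ _ e) ?ge_min ?lexx//; lra.
  have db : d < b - a.
    by rewrite ltr_pdivrMr// (@le_lt_trans _ _ (b - a)) ?ge_min ?lexx ?orbT//; lra.
  exists (a + d); split; first by apply: hS; lra.
  by apply: eU; rewrite /ball /= ltr_norml; lra.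
- pose d := Num.min e (b - a) / 2.
  have d0 : 0 < d by rewrite divr_gt0// lt_min e0 subr_gt0.
  have de : d < e by rewrite ltr_pdivrMr// (@le_lt_trans _ _ e) ?ge_min ?lexx//; lra.
  have db : d < b - a.
    by rewrite ltr_pdivrMr// (@le_lt_trans _ _ (b - a)) ?ge_min ?lexx ?orbT//; lra.
  exists (b - d); split; first by apply: hS; lra.
  by apply: eU; rewrite /ball /= ltr_norml; lra.
Qed.

Lemma continuous_pair (T : topologicalType) (f g : T -> R) :
  continuous f -> continuous g -> continuous (fun x => (f x, g x)).
Proof. by move=> cf cg x; exact: (cvg_pair (cf x) (cg x)). Qed.

Lemma fst_continuous (T U : topologicalType) : continuous (@fst T U).
Proof. by move=> x; exact: cvg_fst. Qed.

Lemma snd_continuous (T U : topologicalType) : continuous (@snd T U).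
Proof. by move=> x; exact: cvg_snd. Qed.

(** An arbitrary lattice subset [E] handles infinitely many translates at once, without a bound on
    the lattice vectors that occur. *)
Lemma compact_lattice_meets A B E : compact A -> compact B -> lattice_subset E ->
  compact [set p | A p /\ exists q, B q /\ E (p.1 - q.1, p.2 - q.2)].
Proof.
move=> cA cB /lattice_subset_closed cE.
pose f (w : (R * R) * (R * R)) := (w.1.1 - w.2.1, w.1.2 - w.2.2).
have cf : continuous f.
  have c1 := @fst_continuous (R * R)%type (R * R)%type.
  have c2 := @snd_continuous (R * R)%type (R * R)%type.
  have d1 := @fst_continuous R R; have d2 := @snd_continuous R R.
  apply: continuous_pair => w; apply: cvgB; apply: continuous_comp;
    [exact: c1|exact: d1|exact: c2|exact: d1|exact: c1|exact: d2|exact: c2|exact: d2].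
rewrite (_ : [set p | _] = fst @` ((A `*` B) `&` f @^-1` E)).
  apply: continuous_compact.
    by apply: continuous_subspaceT => w; exact: fst_continuous.
  apply: compact_closedI; first exact: compact_setX.
  by apply: closed_comp => // w _; exact: cf.
apply/seteqP; split=> [p [Ap [q [Bq Epq]]]|p [[p' q] [[/= Ap Bq] Epq] <-]].
  by exists (p, q).
by split=> //; exists q.
Qed.

Definition shift_levels A E : set R :=
  [set h | exists x x' y', [/\ A (x, h), A (x', y') & E (x - x', h - y')]].

Lemma shift_levels_closed A E :
  compact A -> lattice_subset E -> closed (shift_levels A E).
Proof.
move=> cA lE; apply: compact_closed; first exact: Rhausdorff.
rewrite (_ : shift_levels A E = snd @`
  [set p | A p /\ exists q, A q /\ E (p.1 - q.1, p.2 - q.2)]).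
  apply: continuous_compact; last exact: compact_lattice_meets.
  by apply: continuous_subspaceT => w; exact: snd_continuous.
apply/seteqP; split=> [h [x [x' [y' [Axh Axy Eh]]]]|_ [[x h] [Axh [[x' y'] [Axy Eh]]] <-]].
  by exists (x, h) => //; split=> //; exists (x', y').
by exists x, x', y'.
Qed.

Lemma compact_extrema (T : topologicalType) (A : set T) (f : T -> R) :
  A !=set0 -> compact A -> continuous f ->
  (exists2 p, A p & forall q, A q -> f p <= f q) /\
  (exists2 p, A p & forall q, A q -> f q <= f p).
Proof.
move=> A0 cA cf.
have [p + pm] := compact_EVT_min A0 cA (continuous_subspaceT cf).
have [q + qm] := compact_EVT_max A0 cA (continuous_subspaceT cf).
rewrite !inE => Aq Ap; split.
  by exists p => // r Ar; apply: pm; rewrite inE.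
by exists q => // r Ar; apply: qm; rewrite inE.
Qed.

Lemma slice_segment A h : planar_convex A -> compact A ->
  (exists x, A (x, h)) ->
  exists a b, [/\ a <= b & forall x, A (x, h) <-> a <= x <= b].
Proof.
move=> cvA cA [x0 Ax0].
have cAh : compact (A `&` snd @^-1` [set h]).
  apply: compact_closedI => //; apply: closed_comp; last exact: closed_eq.
  by move=> w _; exact: snd_continuous.
have Ah0 : A `&` snd @^-1` [set h] !=set0 by exists (x0, h).
have [] := compact_extrema Ah0 cAh (@fst_continuous R R).
move=> [[a ha] [Aa /= haE] am] [[b hb] [Ab /= hbE] bm].
rewrite haE in Aa am *; rewrite hbE in Ab bm *.
exists a, b; split; first by apply: (am (b, h)).
move=> x; split=> [Ax|/andP[ax xb]]; last exact: (convex_hseg cvA Aa Ab).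
by apply/andP; split; [apply: (am (x, h))|apply: (bm (x, h))].
Qed.

End Lattice_compactness.

(** * Arcs modulo 1, and the vertical extent around the unit chords *)

Section Slicing.
Variable R : realType.
Implicit Types (A : set (R * R)).

(* [k] is the first index for which [[a', b'] + k] ends beyond [b]. *)
Lemma arcs_overlap (a b a' b' : R) : b < a + 1 -> b' < a' + 1 ->
  (forall x, exists j : int,
     a <= x - j%:~R <= b \/ a' <= x - j%:~R <= b') ->
  exists k : int, a' + k%:~R <= b /\ a + 1 <= b' + k%:~R.
Proof.
move=> ab ab' cov; have [j /andP[j1 j2]] := ex_floor (b - b').
pose k : int := j + 1.
have kE : k%:~R = j%:~R + 1 :> R by rewrite intrD.
have int_ge (m n : int) : (m%:~R < n%:~R + 1 :> R) -> (m <= n)%R.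
  by rewrite (_ : n%:~R + 1 = (n + 1)%:~R :> R); [rewrite ltr_int; lia|rewrite intrD].
have gap (x : R) : b < x -> x < a + 1 -> x < a' + k%:~R \/ b' + k%:~R < x ->
    x < a' + k%:~R + 1 -> False.
  move=> bx xa xk xk1; have [i [/andP[ai ib]|/andP[ai ib]]] := cov x.
    have : (i <= 0)%R by apply: int_ge; lra.
    have : (1 <= i)%R by apply: int_ge; lra.
    lia.
  have : (k <= i)%R by apply: int_ge; lra.
  rewrite le_eqVlt => /predU1P[ki|ki]; first by rewrite -ki in ai ib; lra.
  have : ((k + 1)%:~R <= i%:~R :> R) by rewrite ler_int; lia.
  rewrite intrD; lra.
exists k; have [ak|ak] := lerP (a' + k%:~R) b; last first.
  exfalso; pose x := Num.min (a' + k%:~R) (a + 1).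
  have xb : b < x by rewrite lt_min ak; lra.
  have x1 : x <= a' + k%:~R by rewrite ge_min lexx.
  have x2 : x <= a + 1 by rewrite ge_min lexx orbT.
  by apply: (gap ((b + x) / 2)); lra.
split=> //; rewrite leNgt; apply/negP => bk.
pose x := Num.min (a + 1) (a' + k%:~R + 1).
have xb : b' + k%:~R < x by rewrite lt_min bk; lra.
have x1 : x <= a + 1 by rewrite ge_min lexx.
have x2 : x <= a' + k%:~R + 1 by rewrite ge_min lexx orbT.
by apply: (gap ((b' + k%:~R + x) / 2)); lra.
Qed.

Lemma single_arc_not_covering (a b : R) : b < a + 1 ->
  ~ (forall x, exists j : int, a <= x - j%:~R <= b).
Proof.
move=> ab cov; have [|k [k1 k2]] := @arcs_overlap a b a b ab ab.
  by move=> x; have [j] := cov x; exists j; left.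
have : (k%:~R < 1%:~R :> R) by lra.
have : (0%:~R < k%:~R :> R) by lra.
rewrite !ltr_int; lia.
Qed.

Definition unit_chord A x y := A (x, y) /\ A (x + 1, y).

(** No nonzero lattice vector times a factor above [L] lies in the difference body A - A; when
    attained, [L] is the reciprocal of the first minimum of A - A. *)
Definition maximal_chord A (L : R) :=
  forall (m n : int) x y t, (m, n) <> (0, 0) ->
    A (x, y) -> A (x + t * m%:~R, y + t * n%:~R) -> t <= L.

(* A point more than 1 below all unit chords would form, with the longest
   horizontal chord, a triangle higher than [L]; its difference body then
   contains [t (m, 1)] for some integer [m] and some [t > L]. *)
Lemma chords_low A (L al x0 h0 : R) : planar_convex A -> 1 <= L ->
  A (x0, h0) -> A (x0 + L, h0) -> maximal_chord A L ->
  (forall x y, unit_chord A x y -> al <= y) ->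
  forall x y, A (x, y) -> al - 1 <= y.
Proof.
move=> cA L1 A0 A1 maxL lowU xq yq Aq; rewrite leNgt; apply/negP => low.
have L0 : L != 0 by lra.
pose g := h0 - yq.
(* The triangle with apex (xq, yq) over the longest chord has its slice of length 1 at height g / L
   above the apex. This is a unit chord, so g / L > 1. *)
have gL : L < g.
  have th0 : 0 <= 1 / L by rewrite divr_ge0//; lra.
  have th1 : 1 / L <= 1 by rewrite ler_pdivrMr; lra.
  have U : unit_chord A ((1 - 1 / L) * xq + 1 / L * x0) ((1 - 1 / L) * yq + 1 / L * h0).
    split; first exact: cA.
    by apply: (convex_in cA Aq A1 th0 th1) => //; field.
  have := lowU _ _ U.
  rewrite (_ : _ + _ = yq + g / L); last by rewrite /g; field.
  move=> H; have : 1 < g / L by lra.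
  by rewrite ltr_pdivlMr; lra.
(* At height tau g the difference body of this triangle has width (2 - tau) L. [tau] solves tau g =
   (2 - tau) L: width and height both equal [t], so some multiple t m falls inside. *)
pose tau := 2 * L / (g + L).
have gL0 : g + L != 0 by lra.
have tau0 : 0 < tau by rewrite divr_gt0; lra.
have tau1 : tau < 1 by rewrite ltr_pdivrMr; lra.
pose t := tau * g.
have tL : L < t.
  rewrite /t /tau mulrAC ltr_pdivlMr; last by lra.
  rewrite [X in X < _](_ : _ = L * (g + L))// [X in _ < X](_ : _ = L * (2 * g)); last by ring.
  by rewrite ltr_pM2l; lra.
have tE : t = 2 * L - tau * L by rewrite /t /tau; field.
have t0 : 0 < t by lra.
have [m /andP[m1 m2]] := ex_floor ((tau * (x0 - xq) + L) / t).
have tm1 : t * m%:~R <= tau * (x0 - xq) + L by move: m1; rewrite ler_pdivlMr//; lra.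
have tm2 : tau * (x0 - xq) - (1 - tau) * L <= t * m%:~R.
  by move: m2; rewrite ltr_pdivrMr//; lra.
pose D := t * m%:~R - tau * (x0 - xq).
have seg c : 0 <= c -> c <= L -> A (x0 + c, h0).
  by move=> c0 cL; apply: (convex_hseg cA A0 A1); lra.
suff : t <= L by lra.
have tau_ge0 := ltW tau0; have tau_le1 := ltW tau1.
have tau1_ge0 : 0 <= 1 - tau by lra.
have tau1_le1 : 1 - tau <= 1 by lra.
(* For D >= 0 the chord starts on the side through (x0, h0) and ends [D] further along the longest
   chord; for D < 0 it ends at (x0, h0) and the starting point is moved instead. *)
have [Dp|Dn] := lerP 0 D.
  have DL : D <= L by rewrite /D; lra.
  have P0 := cA _ _ _ _ _ Aq A0 tau1_ge0 tau1_le1.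
  have P1 := seg _ Dp DL.
  apply: (maxL m 1 _ _ t _ P0) => //.
  by congr A: P1; congr pair; rewrite /D ?/t ?/g; ring.
have tau1' : 1 - tau != 0 by lra.
have Dlow : - ((1 - tau) * L) <= D by rewrite /D; lra.
have D0 : 0 <= - D / (1 - tau) by rewrite divr_ge0; lra.
have D1 : - D / (1 - tau) <= L by rewrite ler_pdivrMr; lra.
have P0 := cA _ _ _ _ _ Aq (seg _ D0 D1) tau1_ge0 tau1_le1.
apply: (maxL m 1 _ _ t _ P0) => //.
by congr A: A0; congr pair; rewrite /D ?/t ?/g; field.
Qed.

Lemma chords_high A (L be x0 h0 : R) : planar_convex A -> 1 <= L ->
  A (x0, h0) -> A (x0 + L, h0) -> maximal_chord A L ->
  (forall x y, unit_chord A x y -> y <= be) ->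
  forall x y, A (x, y) -> y <= be + 1.
Proof.
move=> cA L1 A0 A1 maxL highU x y Axy.
suff : - be - 1 <= - y by lra.
apply: (@chords_low (opp_set A) L (- be) (- x0 - L) (- h0) _ L1 _ _ _ _
  (- x)) => /=.
- exact: opp_set_convex.
- by rewrite /opp_set /= opprD !opprK.
- by rewrite /opp_set /= subrK !opprK.
- move=> m n x1 y1 t mn; rewrite /opp_set /= => B0 B1.
  apply: (maxL m n _ _ t mn B1).
  by congr A: B0; congr pair; ring.
- move=> x1 y1; rewrite /unit_chord /opp_set /= => -[B0 B1].
  have : - y1 <= be by apply: (highU (- (x1 + 1))); split=> //; rewrite opprD subrK.
  lra.
- by rewrite /opp_set /= !opprK; exact: Axy.
Qed.

End Slicing.

(** * Inscribed triangles when the longest lattice chord is horizontal *)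

Section Inscribed.
Variable R : realType.
Implicit Types (A : set (R * R)).

Definition meets A (k : int) (h : R) :=
  exists x, A (x, h) /\ A (x - k%:~R, h - 1).

(** Without unit chords both slices are shorter than 1, so they cover the circle R/Z only as two
    arcs that overlap at both ends; the two overlaps have consecutive indices. *)
Lemma slices_overlap A (h : R) : planar_convex A -> compact A ->
  (forall x, ~ unit_chord A x h) -> (forall x, ~ unit_chord A x (h - 1)) ->
  (forall x, exists j : int, A (x - j%:~R, h) \/ A (x - j%:~R, h - 1)) ->
  exists k : int, meets A k h /\ meets A (k - 1) h.
Proof.
move=> cvA cA U0 U1 cov.
have short a b l : a <= b -> (forall x, A (x, l) <-> a <= x <= b) ->
    (forall x, ~ unit_chord A x l) -> b < a + 1.
  move=> ab sl U; rewrite ltNge; apply/negP => ba; apply: (U a).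
  by split; apply/sl; rewrite ?lexx; lra.
have [ne0|e0] := pselect (exists x, A (x, h)); last first.
  have [ne1|e1] := pselect (exists x, A (x, h - 1)); last first.
    have [j [?|?]] := cov 0; exfalso; first by apply: e0; exists (0 - j%:~R).
    by apply: e1; exists (0 - j%:~R).
  have [a [b [ab sl]]] := slice_segment cvA cA ne1.
  exfalso; apply: (single_arc_not_covering (short _ _ _ ab sl U1)) => x.
  have [j [H|H]] := cov x; first by exfalso; apply: e0; exists (x - j%:~R).
  by exists j; apply/sl.
have [a [b [ab sl]]] := slice_segment cvA cA ne0.
have abs := short _ _ _ ab sl U0.
have [ne1|e1] := pselect (exists x, A (x, h - 1)); last first.
  exfalso; apply: (single_arc_not_covering abs) => x.
  have [j [H|H]] := cov x; last by exfalso; apply: e1; exists (x - j%:~R).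
  by exists j; apply/sl.
have [a' [b' [ab' sl']]] := slice_segment cvA cA ne1.
have abs' := short _ _ _ ab' sl' U1.
have [x|k [k1 k2]] := @arcs_overlap R a b a' b' abs abs'.
  by have [j [/sl H|/sl' H]] := cov x; exists j; [left|right].
exists k; split.
- exists (Num.max a (a' + k%:~R)).
  have m1 : a <= Num.max a (a' + k%:~R) by rewrite le_max lexx.
  have m2 : a' + k%:~R <= Num.max a (a' + k%:~R) by rewrite le_max lexx orbT.
  have m3 : Num.max a (a' + k%:~R) <= b by rewrite ge_max ab.
  have m4 : Num.max a (a' + k%:~R) <= b' + k%:~R by rewrite ge_max; lra.
  by split; [apply/sl|apply/sl']; lra.
- exists (Num.max a (a' + k%:~R - 1)).
  have m1 : a <= Num.max a (a' + k%:~R - 1) by rewrite le_max lexx.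
  have m2 : a' + k%:~R - 1 <= Num.max a (a' + k%:~R - 1) by rewrite le_max lexx orbT.
  have m3 : Num.max a (a' + k%:~R - 1) <= b by rewrite ge_max ab; lra.
  have m4 : Num.max a (a' + k%:~R - 1) <= b' + k%:~R - 1 by rewrite ge_max; lra.
  by rewrite intrB; split; [apply/sl|apply/sl']; lra.
Qed.

(** The horizontal displacements between the two overlap points in the two slices add up to i - j;
    if this were 2 or more, one slice would contain a unit chord. *)
Lemma meets_close A (h : R) (i j : int) : planar_convex A ->
  (forall x, ~ unit_chord A x h) -> (forall x, ~ unit_chord A x (h - 1)) ->
  meets A i h -> meets A j h -> i < j + 2.
Proof.
move=> cvA U0 U1 [c [c0 c1]] [d [d0 d1]].
have near l x y : (forall x, ~ unit_chord A x l) -> A (x, l) -> A (y, l) -> y < x + 1.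
  move=> U Ax Ay; rewrite ltNge; apply/negP => xy; apply: (U x); split=> //.
  by apply: (convex_hseg cvA Ax Ay); lra.
have := near _ _ _ U0 d0 c0; have := near _ _ _ U1 c1 d1.
move=> H1 H2; have : (i%:~R < (j + 2)%:~R :> R) by rewrite intrD; lra.
by rewrite ltr_int.
Qed.

Lemma meets_shift_levels A k :
  meets A k = shift_levels A [set p | p = (k%:~R, 1%:~R)].
Proof.
apply/seteqP; split=> h.
  move=> [x [A0 A1]]; exists x, (x - k%:~R), (h - 1); split=> //=.
  by rewrite !subKr.
move=> [x [x' [y' [A0 A1 /= [xE yE]]]]]; exists x; split=> //.
by congr A: A1; congr pair; lra.
Qed.

Lemma meets_closed A k : compact A -> closed (meets A k).
Proof.
move=> cA; rewrite meets_shift_levels; apply: shift_levels_closed => //.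
by move=> p ->; exists k, 1.
Qed.

(* Between the highest unit chord and 1 above the lowest one, the overlap index
   is locally constant, hence constant, and persists at both ends. *)
Lemma constant_overlap A (al be : R) : planar_convex A -> compact A ->
  be < al + 1 ->
  (forall x y, unit_chord A x y -> al <= y <= be) ->
  (forall x y, A (x, y) -> al - 1 <= y <= be + 1) -> covers A ->
  exists k : int, forall h, be <= h -> h <= al + 1 ->
    meets A k h /\ meets A (k - 1) h.
Proof.
move=> cvA cA bal Ual lev cov.
pose J : set R := `]be, al + 1[%classic.
have JP h : J h <-> be < h < al + 1 by rewrite /J /= in_itv.
have U0 h : J h -> forall x, ~ unit_chord A x h.
  by move=> /JP Jh x /Ual; lra.
have U1 h : J h -> forall x, ~ unit_chord A x (h - 1).
  by move=> /JP Jh x /Ual; lra.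
have ex h : J h -> exists k : int, meets A k h /\ meets A (k - 1) h.
  move=> Jh; apply: slices_overlap => //; [exact: U0|exact: U1|].
  move=> x; have [j [n An]] := cov x h; exists j.
  have := lev _ _ An; move/JP: Jh => Jh Hn.
  (* [A] lives between the levels al - 1 and be + 1, and be < h < al + 1, so no other row of
     translates reaches level [h]. *)
  have [n0|n1] : n = 0 \/ n = 1.
    have : ((-1)%:~R < n%:~R :> R) by lra.
    have : (n%:~R < 2%:~R :> R) by lra.
    by rewrite !ltr_int; lia.
  - by left; rewrite n0 subr0 in An.
  - by right; rewrite n1 in An.
have Jm : J ((be + (al + 1)) / 2) by apply/JP; lra.
have [k [k1 k2]] := ex _ Jm.
(* Levels with an overlap of index other than k and k - 1. [F] is closed although infinitely many
   indices occur, so its complement makes the set of levels with indices k and k - 1 open in [J]. *)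
pose F := shift_levels A [set p | exists j : int,
  (k + 1 <= j \/ j <= k - 2) /\ p = (j%:~R, 1%:~R)].
have cF : closed F.
  by apply: shift_levels_closed => // p [j [_ ->]]; exists j, 1.
have inF j h : (k + 1 <= j \/ j <= k - 2) -> meets A j h -> F h.
  move=> kj [x [A0 A1]]; exists x, (x - j%:~R), (h - 1); split=> //=.
  by exists j; rewrite !subKr.
have FP h : F h -> exists j : int, (k + 1 <= j \/ j <= k - 2) /\ meets A j h.
  move=> [x [x' [y' [A0 A1 /= [j [kj [xE yE]]]]]]]; exists j; split=> //.
  by exists x; split=> //; congr A: A1; congr pair; lra.
have JW : J `&` (meets A k `&` meets A (k - 1)) = J.
  have cJ : connected J by apply/connected_intervalP; exact: interval_is_interval.
  apply: cJ.
  - by exists ((be + (al + 1)) / 2).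
  - exists (~` F); first exact: closed_openC.
    apply/seteqP; split=> h [Jh]; last first.
      move=> nF; split=> //; have [k' [m1 m2]] := ex _ Jh.
      have [kk|kk] := eqVneq k' k; first by rewrite -kk.
      exfalso; apply: nF; have [k'k|k'k] : k + 1 <= k' \/ k' <= k - 1 by lia.
        by apply: (inF k') => //; left.
      by apply: (inF (k' - 1)) => //; right; lia.
    move=> [m1 m2]; split=> // /FP[j [[kj|kj] mj]].
      have := meets_close cvA (U0 _ Jh) (U1 _ Jh) mj m2; lia.
    have := meets_close cvA (U0 _ Jh) (U1 _ Jh) m1 mj; lia.
  - exists (meets A k `&` meets A (k - 1)) => //.
    by apply: closedI; exact: meets_closed.
have W h : be < h -> h < al + 1 -> meets A k h /\ meets A (k - 1) h.
  by move=> h1 h2; have : J h by [apply/JP; rewrite h1]; rewrite -JW => -[].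
have [W1 W2] := closed_itv_ends (meets_closed (k := k) cA) bal (fun h h1 h2 => (W h h1 h2).1).
have [W3 W4] := closed_itv_ends (meets_closed (k := k - 1) cA) bal (fun h h1 h2 => (W h h1 h2).2).
exists k => h; rewrite le_eqVlt => /predU1P[<-//|h1].
by rewrite le_eqVlt => /predU1P[->//|h2]; exact: W.
Qed.

(** Let [al] and [be] be the extreme levels of unit chords. If they are at least 1 apart,
    interpolation gives unit chords at [al] and al + 1, whose parallelogram contains both triangles.
    Otherwise the overlaps at level al + 1 give [T] above a unit chord at [al], those at level [be]
    give [-T] below a unit chord at [be], and the constant index [k] makes it the same [T]. *)
Lemma inscribed_triangles_standard A (L x0 h0 : R) : planar_convex A ->
  compact A -> covers A -> 1 <= L -> A (x0, h0) -> A (x0 + L, h0) ->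
  maximal_chord A L ->
  exists k : int, has_triangle A 1 1 0 k 1 /\ has_triangle A (-1) 1 0 k 1.
Proof.
move=> cvA cA cov L1 A0 A1 maxL.
pose U : set (R * R) := [set p | unit_chord A p.1 p.2].
have cU : compact U.
  rewrite (_ : U = [set p | A p /\ exists q, A q /\
    [set r | r = (-1, 0)] (p.1 - q.1, p.2 - q.2)]).
    by apply: compact_lattice_meets => // p ->; exists (-1), 0.
  apply/seteqP; split=> -[x y] /=.
    move=> [Ax Ax1]; split=> //; exists (x + 1, y); split=> //=.
    by congr pair; lra.
  move=> [Ax [[x' y'] [Ax' /= [xE yE]]]]; split=> //.
  by congr A: Ax'; congr pair => /=; lra.
have U0 : U !=set0.
  by exists (x0, h0); split=> //=; apply: (convex_hseg cvA A0 A1); lra.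
have [[[xa al] [/= Aa Aa1] amin] [[xb be] [/= Ab Ab1] bmax]] :=
  compact_extrema U0 cU (@snd_continuous R R).
have Ual x y : unit_chord A x y -> al <= y <= be.
  by move=> Uxy; rewrite (amin (x, y) Uxy) (bmax (x, y) Uxy).
have lev x y : A (x, y) -> al - 1 <= y <= be + 1.
  move=> Axy; apply/andP; split.
    by apply: (chords_low cvA L1 A0 A1 maxL _ Axy) => x' y' /Ual /andP[].
  by apply: (chords_high cvA L1 A0 A1 maxL _ Axy) => x' y' /Ual /andP[].
have [bal|bal] := lerP (al + 1) be.
  pose t := 1 / (be - al).
  have t0 : 0 <= t by rewrite divr_ge0; lra.
  have t1 : t <= 1 by rewrite ler_pdivrMr; lra.
  pose x := (1 - t) * xa + t * xb.
  have Ax : A (x, al + 1).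
    by apply: (convex_in cvA Aa Ab t0 t1) => //; rewrite /t; field; lra.
  have Ax1 : A (x + 1, al + 1).
    by apply: (convex_in cvA Aa1 Ab1 t0 t1); rewrite /x /t; field; lra.
  have [k /andP[k1 k2]] := ex_floor (x + 1 - xa).
  exists k; split.
    exists xa, al; split=> //; first by congr A: Aa1; congr pair; ring.
    by rewrite !mul1r; apply: (convex_hseg cvA Ax Ax1); lra.
  exists (x + 1), (al + 1); split=> //; first by congr A: Ax; congr pair; ring.
  rewrite (_ : al + 1 + _ = al); last by ring.
  by apply: (convex_hseg cvA Aa Aa1); lra.
have [k ov] := constant_overlap cvA cA bal Ual lev cov.
exists k; split.
- have [||[c [c0 c1]] [d [d0 d1]]] := ov (al + 1); rewrite ?lexx ?ltW//.
  rewrite addrK in c1 d1; rewrite intrB in d1.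
  suff [x [B0 B1 B2]] : exists x, [/\ A (x, al), A (x + 1, al) &
      A (x + k%:~R, al + 1)].
    by exists x, al; rewrite !mul1r mulr0z addr0.
  (* Base and apex slide together: the slice at [al] contains c - k, d - k + 1 and the chord at xa,
     the slice above contains [c] and [d]. If neither overlap point extends the chord suitably, xa +
     k lies between [d] and [c]. *)
  have [cx|cx] := lerP (c - k%:~R) xa.
    exists (c - k%:~R); split=> //; last by rewrite subrK.
    by apply: (convex_hseg cvA c1 Aa1); lra.
  have [dx|dx] := lerP (xa + 1) (d - k%:~R + 1).
    exists (d - k%:~R); split.
    + by apply: (convex_hseg cvA Aa d1); lra.
    + by congr A: d1; congr pair; ring.
    + by rewrite subrK.
  by exists xa; split=> //; apply: (convex_hseg cvA d0 c0); lra.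
- have [||[c [c0 c1]] [d [d0 d1]]] := ov be; rewrite ?lexx ?ltW//.
  rewrite intrB in d1.
  suff [x [B0 B1 B2]] : exists x, [/\ A (x, be), A (x - 1, be) &
      A (x - k%:~R, be - 1)].
    exists x, be; split=> //; first by congr A: B1; congr pair; ring.
    by congr A: B2; congr pair; ring.
  have [cx|cx] := lerP (xb + 1) c.
    exists c; split=> //.
    by apply: (convex_hseg cvA Ab c0); lra.
  have [dx|dx] := lerP d xb.
    exists (d + 1); split.
    + by apply: (convex_hseg cvA d0 Ab1); lra.
    + by rewrite addrK.
    + by congr A: d1; congr pair; ring.
  exists (xb + 1); split=> //; first by rewrite addrK.
  by apply: (convex_hseg cvA c1 d1); lra.
Qed.

End Inscribed.

(** * The longest lattice chord and a basis adapted to it *)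

Section Shortest_vector.
Variable R : realType.
Implicit Types (A : set (R * R)).

Definition nonzero_lattice : set (R * R) :=
  [set p | exists m n : int, (m, n) <> (0, 0) /\ p = (m%:~R, n%:~R)].

Lemma nonzero_lattice_closed : closed nonzero_lattice.
Proof.
by apply: lattice_subset_closed => p [m [n [_ ->]]]; exists m, n.
Qed.

(* A rightmost point of [A] is a limit of points covered by other translates. *)
Lemma covers_lattice_difference A : compact A -> covers A ->
  exists (m n : int) x y,
    [/\ (m, n) <> (0, 0), A (x, y) & A (x + m%:~R, y + n%:~R)].
Proof.
move=> cA cov.
have A0 : A !=set0.
  by have [m [n Amn]] := cov 0 0; exists (0 - m%:~R, 0 - n%:~R).
have [_ [[xm ym] Am xmax]] := compact_extrema A0 cA (@fst_continuous R R).
pose B : set (R * R) := (fun t => (xm + t, ym)) @` `[0, 1]%classic.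
have cB : compact B.
  apply: continuous_compact; last exact: segment_compact.
  apply: continuous_subspaceT; apply: continuous_pair => t.
    by apply: cvgD; [exact: cvg_cst|exact: cvg_id].
  exact: cvg_cst.
have lnz : lattice_subset nonzero_lattice.
  by move=> p [m [n [_ ->]]]; exists m, n.
have cM := compact_lattice_meets cB cA lnz.
have cM' : compact ((fun p => p.1 - xm) @` [set p | B p /\ exists q, A q /\
    nonzero_lattice (p.1 - q.1, p.2 - q.2)]).
  apply: continuous_compact => //; apply: continuous_subspaceT => p.
  by apply: cvgB; [exact: fst_continuous|exact: cvg_cst].
have {cM cM'} cS := compact_closed (@Rhausdorff R) cM'.
have [|+ _] := closed_itv_ends cS (@ltr01 R).
  move=> t t0 t1; have [m [n Amn]] := cov (xm + t) ym.
  exists (xm + t, ym); last by rewrite /=; ring.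
  split; first by exists t => //; rewrite /= in_itv /= !ltW.
  exists (xm + t - m%:~R, ym - n%:~R); split=> //=.
  exists m, n; split; last by rewrite !subKr.
  by move=> -[m0 n0]; have := xmax _ Amn; rewrite m0 /=; lra.
move=> [[x y] [/= [t _ [txE tyE]] [[x' y'] [Aq [m [n [mn [/= xE yE]]]]]]] xxm].
exists m, n, x', y'; split=> //.
by congr A: Am; congr pair; lra.
Qed.

(** The reciprocal s = 1 / L is minimised over triples (p, q, s) with s (q - p) a nonzero lattice
    vector. Restricting [s] to [0, 1] keeps this set compact, a lattice difference makes it
    non-empty at s = 1, and s = 0 would give the zero vector. *)
Lemma covers_maximal_chord A : compact A -> covers A ->
  exists (m n : int) x y L, [/\ (m, n) <> (0, 0), 1 <= L, A (x, y),
    A (x + L * m%:~R, y + L * n%:~R) & maximal_chord A L].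
Proof.
move=> cA cov.
have [m0 [n0 [x0 [y0 [mn0 A0 A1]]]]] := covers_lattice_difference cA cov.
pose f (w : ((R * R) * (R * R)) * R) :=
  (w.2 * (w.1.2.1 - w.1.1.1), w.2 * (w.1.2.2 - w.1.1.2)).
have cf : continuous f.
  have c1 := @fst_continuous ((R * R) * (R * R))%type R.
  have c2 := @snd_continuous ((R * R) * (R * R))%type R.
  have cc (T U V : topologicalType) (g : T -> U) (h : U -> V) :
    continuous g -> continuous h -> continuous (h \o g).
    by move=> cg ch z; apply: continuous_comp; [exact: cg|exact: ch].
  have d1 := cc _ _ _ _ _ c1 (@fst_continuous (R * R)%type (R * R)%type).
  have d2 := cc _ _ _ _ _ c1 (@snd_continuous (R * R)%type (R * R)%type).
  have e1 := @fst_continuous R R; have e2 := @snd_continuous R R.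
  apply: continuous_pair => w; (apply: cvgM; first exact: c2); apply: cvgB.
  - exact: (cc _ _ _ _ _ d2 e1).
  - exact: (cc _ _ _ _ _ d1 e1).
  - exact: (cc _ _ _ _ _ d2 e2).
  - exact: (cc _ _ _ _ _ d1 e2).
pose K := ((A `*` A) `*` `[0, 1]%classic) `&` f @^-1` nonzero_lattice.
have cK : compact K.
  apply: compact_closedI.
    by apply: compact_setX; [exact: compact_setX|exact: segment_compact].
  by apply: closed_comp => [w _|]; [exact: cf|exact: nonzero_lattice_closed].
have K0 : K !=set0.
  exists (((x0, y0), (x0 + m0%:~R, y0 + n0%:~R)), 1); split.
    by split=> //=; rewrite in_itv /= ler01 lexx.
  exists m0, n0; split=> //; rewrite /f /= !mul1r.
  by congr pair; ring.
have [[[[[x y] [x' y']] s] [[[/= Axy Axy'] s01] [m [n [mn [/= xE yE]]]]] smin] _] :=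
  compact_extrema K0 cK (@snd_continuous _ R).
rewrite /= in_itv /= in s01; case/andP: s01 => s0 s1.
have sn0 : s != 0.
  apply/eqP => sz; apply: mn; rewrite sz !mul0r in xE yE.
  by congr pair; apply/eqP; rewrite -(@intr_eq0 R) -?xE -?yE.
have sp : 0 < s by rewrite lt_def sn0.
exists m, n, x, y, (1 / s); split=> //.
- by rewrite ler_pdivlMr// mul1r.
- by congr A: Axy'; congr pair; rewrite -?xE -?yE; field.
move=> m' n' u v t mn' Auv Auv'.
have [t1|t1] := lerP t 1.
  by rewrite (le_trans t1)// ler_pdivlMr// mul1r.
have tn0 : t != 0 by rewrite gt_eqF// (lt_trans ltr01).
have : s <= 1 / t.
  apply: (smin (((u, v), (u + t * m'%:~R, v + t * n'%:~R)), 1 / t)); split.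
    split=> //=; rewrite in_itv /=; apply/andP; split; first by rewrite divr_ge0//; lra.
    by rewrite ler_pdivrMr; lra.
  by exists m', n'; split=> //; rewrite /f /=; congr pair; field.
rewrite ler_pdivlMr; last lra.
by rewrite ler_pdivlMr// mulrC.
Qed.

(** Measured by the primitive vector of its direction, the chord has length [L] times the gcd, which
    maximality bounds by [L]. *)
Lemma maximal_chord_primitive A (L : R) (m n : int) x y : (m, n) <> (0, 0) ->
  1 <= L -> A (x, y) -> A (x + L * m%:~R, y + L * n%:~R) ->
  maximal_chord A L -> exists v w : int, unimodular m n v w.
Proof.
move=> mn L1 A0 A1 maxL.
have [u [v uv]] := Bezoutz m n.
suff g1 : gcdz m n = 1.
  by exists (- v), u; rewrite /unimodular mulrN opprK mulrC [n * v]mulrC uv g1.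
have [m' mE] : exists m', m = m' * gcdz m n.
  by apply/dvdzP; exact: dvdz_gcdl.
have [n' nE] : exists n', n = n' * gcdz m n.
  by apply/dvdzP; exact: dvdz_gcdr.
have g0 : 0 <= gcdz m n by [].
set d := gcdz m n in mE nE g0 *.
have mn' : (m', n') <> (0, 0).
  by move=> -[m0 n0]; apply: mn; rewrite mE nE m0 n0 !mul0r.
have dn0 : d != 0.
  by apply/eqP => dz; apply: mn; rewrite mE nE dz !mulr0.
have : L * d%:~R <= L.
  apply: (maxL m' n' _ _ _ mn' A0).
  by congr A: A1; congr pair; rewrite ?mE ?nE intrM; ring.
rewrite -[X in _ <= X]mulr1 ler_pM2l; last lra.
by rewrite (_ : 1 = 1%:~R :> R)// ler_int; lia.
Qed.

Lemma in_basis_compact A u1 u2 v1 v2 : unimodular u1 u2 v1 v2 ->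
  compact A -> compact (in_basis A u1 u2 v1 v2).
Proof.
move=> uv cA; have uvR := unimodularR R uv.
pose d : R := u1%:~R * v2%:~R - u2%:~R * v1%:~R.
pose f (p : R * R) := (d * (p.1 * v2%:~R - p.2 * v1%:~R), d * (p.2 * u1%:~R - p.1 * u2%:~R)).
rewrite (_ : in_basis A u1 u2 v1 v2 = f @` A).
  apply: continuous_compact => //; apply: continuous_subspaceT.
  have e1 := @fst_continuous R R; have e2 := @snd_continuous R R.
  apply: continuous_pair => p; (apply: cvgM; first exact: cvg_cst);
    apply: cvgB; apply: cvgM; do ?[exact: cvg_cst|exact: e1|exact: e2].
apply/seteqP; split=> [[x y]|_ [[x y] Axy <-]]; rewrite /in_basis /=.
  move=> Axy; eexists; first exact: Axy.
  rewrite /f /d /=; congr pair.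
    by apply: (eq_mod1 (c := x) uvR); ring.
  by apply: (eq_mod1 (c := y) uvR); ring.
congr A: Axy; congr pair; rewrite /f /d /=.
  by apply: (eq_mod1 (c := - x) uvR); ring.
by apply: (eq_mod1 (c := - y) uvR); ring.
Qed.

Lemma inscribed_triangles A : planar_convex A -> compact A -> covers A ->
  exists u1 u2 v1 v2, [/\ unimodular u1 u2 v1 v2,
    has_triangle A 1 u1 u2 v1 v2 & has_triangle A (-1) u1 u2 v1 v2].
Proof.
move=> cvA cA cov.
have [m [n [x [y [L [mn L1 A0 A1 maxL]]]]]] := covers_maximal_chord cA cov.
have [v [w U]] := maximal_chord_primitive mn L1 A0 A1 maxL.
have UR := unimodularR R U.
pose B := in_basis A m n v w.
pose d : R := m%:~R * w%:~R - n%:~R * v%:~R.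
have [] : exists x0 h0, B (x0, h0) /\ B (x0 + L, h0).
  exists (d * (x * w%:~R - y * v%:~R)), (d * (y * m%:~R - x * n%:~R)).
  split; rewrite /B /in_basis /=.
    congr A: A0; congr pair; rewrite /d.
      by apply: (eq_mod1 (c := - x) UR); ring.
    by apply: (eq_mod1 (c := - y) UR); ring.
  congr A: A1; congr pair; rewrite /d.
    by apply: (eq_mod1 (c := - x) UR); ring.
  by apply: (eq_mod1 (c := - y) UR); ring.
move=> x0 [h0 [B0 B1]].
have maxB : maximal_chord B L.
  move=> a b x1 y1 t ab; rewrite /B /in_basis /= => C0 C1.
  apply: (maxL (a * m + b * v) (a * n + b * w) _ _ t _ C0).
    move=> -[e1 e2]; apply: ab; congr pair.
      rewrite -[LHS]mulr1 -U.
      transitivity ((m * w - n * v) * ((a * m + b * v) * w - (a * n + b * w) * v)).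
        ring.
      by rewrite e1 e2 !mul0r subr0 mulr0.
    rewrite -[LHS]mulr1 -U.
    transitivity ((m * w - n * v) * ((a * n + b * w) * m - (a * m + b * v) * n)).
      ring.
    by rewrite e1 e2 !mul0r subr0 mulr0.
  by congr A: C1; congr pair; rewrite !(intrD, intrM); ring.
have [k [T T']] := inscribed_triangles_standard (in_basis_convex cvA)
  (in_basis_compact U cA) ((in_basis_covers _ U).1 cov) L1 B0 B1 maxB.
exists (1 * m + 0 * v), (1 * n + 0 * w), (k * m + 1 * v), (k * n + 1 * w); split.
- by rewrite /unimodular -[RHS]U; ring.
- exact/(in_basis_has_triangle _ _ _ _ _ _ U).
- exact/(in_basis_has_triangle _ _ _ _ _ _ U).
Qed.

End Shortest_vector.

(** * Covering radii *)

Section Plane_coordinates.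
Variable R : realType.
Implicit Types (A B : set (R * R)) (K : set 'rV[R]_2).

Definition plane K : set (R * R) := [set p | K (vec2 p.1 p.2)].

Definition scaled (mu : R) A : set (R * R) :=
  [set p | exists x y, A (x, y) /\ p = (mu * x, mu * y)].

Definition sum_set A B : set (R * R) :=
  [set p | exists x y x' y', [/\ A (x, y), B (x', y') & p = (x + x', y + y')]].

Lemma vec2_eta (v : 'rV[R]_2) : v = vec2 (v 0 0) (v 0 1).
Proof.
apply/rowP => i; rewrite mxE; case: i => [[|[|//]]] /= lti;
  by congr (v _ _); apply: val_inj.
Qed.

Lemma vec2D (a b c d : R) : vec2 a b + vec2 c d = vec2 (a + c) (b + d).
Proof. by apply/rowP => i; rewrite !mxE; case: i => [[|[|//]]]. Qed.

Lemma vec2Z (c a b : R) : c *: vec2 a b = vec2 (c * a) (c * b).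
Proof. by apply/rowP => i; rewrite !mxE; case: i => [[|[|//]]]. Qed.

Lemma vec2_inj (a b c d : R) : vec2 a b = vec2 c d -> (a, b) = (c, d).
Proof. by move=> /rowP e; have := e 0; have := e 1; rewrite !mxE /= => -> ->. Qed.

Lemma integer_latticeP (v : 'rV[R]_2) :
  integer_lattice R 2 v <-> exists m n : int, v = vec2 m%:~R n%:~R.
Proof.
split=> [/mxOverP zv|[m [n ->]]].
  have /intrP[m mE] := zv 0 0; have /intrP[n nE] := zv 0 1.
  by exists m, n; rewrite [v]vec2_eta mE nE.
apply/mxOverP => i j; rewrite !mxE.
by case: j => [[|[|//]]] /= _; rewrite intr_int.
Qed.

Lemma plane_dilate (mu : R) K : plane (dilate mu K) = scaled mu (plane K).
Proof.
apply/seteqP; split=> -[x y]; rewrite /plane /=.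
  move=> [v Kv]; rewrite [v]vec2_eta vec2Z => /vec2_inj e.
  by exists (v 0 0), (v 0 1); rewrite /= -vec2_eta.
by move=> [a [b [Kab [-> ->]]]]; exists (vec2 a b) => //; rewrite vec2Z.
Qed.

Lemma plane_minkowski_sum K K' :
  plane (minkowski_sum K K') = sum_set (plane K) (plane K').
Proof.
apply/seteqP; split=> -[x y]; rewrite /plane /=.
  move=> [v Kv [w Kw]]; rewrite [v]vec2_eta [w]vec2_eta vec2D => /vec2_inj e.
  by exists (v 0 0), (v 0 1), (w 0 0), (w 0 1); rewrite /= -!vec2_eta.
move=> [a [b [c [d [Kab Kcd [-> ->]]]]]].
by exists (vec2 a b) => //; exists (vec2 c d) => //; rewrite vec2D.
Qed.

Lemma covers_plane K :
  minkowski_sum K (integer_lattice R 2) = setT <-> covers (plane K).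
Proof.
split=> [cov x y|cov].
  have : minkowski_sum K (integer_lattice R 2) (vec2 x y) by rewrite cov.
  move=> [v Kv [w /integer_latticeP[m [n ->]]]].
  rewrite [v]vec2_eta vec2D => /vec2_inj[<- <-].
  by exists m, n; rewrite /plane /= !addrK -vec2_eta.
apply/seteqP; split=> // v _.
have [m [n Kmn]] := cov (v 0 0) (v 0 1).
exists (vec2 (v 0 0 - m%:~R) (v 0 1 - n%:~R)) => //.
exists (vec2 m%:~R n%:~R); first by apply/integer_latticeP; exists m, n.
by rewrite vec2D !subrK -vec2_eta.
Qed.

Lemma plane_compact K : compact K -> compact (plane K).
Proof.
move=> cK.
rewrite (_ : plane K = (fun v : 'rV[R]_2 => (v 0 0, v 0 1)) @` K).
  apply: continuous_compact => //; apply: continuous_subspaceT.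
  by apply: continuous_pair; exact: coord_continuous.
apply/seteqP; split=> [[x y] Kxy|_ [v Kv <-]]; last first.
  by rewrite /plane /= -vec2_eta.
by exists (vec2 x y) => //; rewrite !mxE.
Qed.

Lemma plane_convex K : convex_set K -> planar_convex (plane K).
Proof.
move=> cK x y x' y' t Kx Kx' t0 t1.
have t01 : 0 <= 1 - t <= 1 by lra.
have := cK (vec2 x y) (vec2 x' y') (Itv01 (proj1 (andP t01)) (proj2 (andP t01))).
rewrite !inE => /(_ Kx Kx'); rewrite /conv /=.
by rewrite !vec2Z vec2D /plane /= /unstable.onem subKr.
Qed.

Lemma covering_radiusE K : covering_radius K =
  ereal_inf [set mu%:E | mu in [set mu | 0 <= mu /\ covers (scaled mu (plane K))]].
Proof.
rewrite /covering_radius; congr (ereal_inf (_ @` _)); apply/seteqP.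
split=> mu [mu0 cov]; split=> //; first by rewrite -plane_dilate; exact/covers_plane.
by apply/covers_plane; rewrite plane_dilate.
Qed.

Lemma scaled_covers_gt0 (mu : R) A : 0 <= mu -> covers (scaled mu A) -> 0 < mu.
Proof.
move=> mu0 cov; rewrite lt_def mu0 andbT; apply/eqP => muE.
have [m [n [x [y [_ [mE _]]]]]] := cov (1 / 2) 0.
rewrite muE mul0r in mE.
have : (0%:~R < m%:~R :> R) by lra.
have : (m%:~R < 1%:~R :> R) by lra.
rewrite !ltr_int; lia.
Qed.

Lemma scaled_convex (mu : R) A : planar_convex A -> planar_convex (scaled mu A).
Proof.
move=> cA x y x' y' t [a [b [Aab [-> ->]]]] [a' [b' [Aab' [-> ->]]]] t0 t1.
exists ((1 - t) * a + t * a'), ((1 - t) * b + t * b'); split; first exact: cA.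
by congr pair; ring.
Qed.

Lemma scaled_compact (mu : R) A : compact A -> compact (scaled mu A).
Proof.
move=> cA; rewrite (_ : scaled mu A = (fun p => (mu * p.1, mu * p.2)) @` A).
  apply: continuous_compact => //; apply: continuous_subspaceT.
  by apply: continuous_pair => p; apply: cvgM;
    [exact: cvg_cst|exact: fst_continuous|exact: cvg_cst|exact: snd_continuous].
apply/seteqP; split=> [_ [x [y [Axy ->]]]|_ [[x y] Axy <-]]; first by exists (x, y).
by exists x, y.
Qed.

Lemma sum_set_convex A B :
  planar_convex A -> planar_convex B -> planar_convex (sum_set A B).
Proof.
move=> cA cB x y x' y' t [a [b [c [d [Aab Bcd [-> ->]]]]]]
  [a' [b' [c' [d' [Aab' Bcd' [-> ->]]]]]] t0 t1.
exists ((1 - t) * a + t * a'), ((1 - t) * b + t * b'),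
  ((1 - t) * c + t * c'), ((1 - t) * d + t * d'); split; [exact: cA|exact: cB|].
by congr pair; ring.
Qed.

Lemma sum_set_covers A B (mu : R) :
  A !=set0 -> covers (scaled mu B) -> covers (scaled mu (sum_set A B)).
Proof.
move=> [[a b] Aab] cov x y.
have [m [n [c [d [Bcd [mE nE]]]]]] := cov (x - mu * a) (y - mu * b).
exists m, n, (a + c), (b + d); split; first by exists a, b, c, d.
by congr pair; rewrite mulrDr -?mE -?nE; ring.
Qed.

Lemma scaled_sum_covers A B (mu1 mu2 : R) :
  planar_convex A -> planar_convex B -> compact A -> compact B ->
  0 < mu1 -> 0 < mu2 -> covers (scaled mu1 A) -> covers (scaled mu2 B) ->
  covers (scaled (4 / 3 * (mu1 * mu2 / (mu1 + mu2))) (sum_set A B)).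
Proof.
move=> cvA cvB cA cB m1 m2 cov1 cov2.
have [u1 [u2 [v1 [v2 [U TA TA']]]]] := inscribed_triangles
  (scaled_convex (mu := mu1) cvA) (scaled_compact (mu := mu1) cA) cov1.
have [p1 [p2 [q1 [q2 [P TB TB']]]]] := inscribed_triangles
  (scaled_convex (mu := mu2) cvB) (scaled_compact (mu := mu2) cB) cov2.
have m12 : 0 < mu1 + mu2 by lra.
pose l := mu2 / (mu1 + mu2).
have l0 : 0 <= l by rewrite divr_ge0; lra.
have l1 : l <= 1 by rewrite ler_pdivrMr; lra.
have [a1 [a2 [b1 [b2 [D T T']]]]] := mix_three_quarters l0 l1
  (scaled_convex (mu := mu1) cvA) (scaled_convex (mu := mu2) cvB) U P TA TA' TB TB'.
have sub x y : mix l (scaled mu1 A) (scaled mu2 B) (x, y) ->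
    scaled (4 / 3 * (mu1 * mu2 / (mu1 + mu2))) (sum_set A B) (4 / 3 * x, 4 / 3 * y).
  move=> [_ [_ [_ [_ [[a [b [Aab [-> ->]]]] [c [d [Bcd [-> ->]]]] [-> ->]]]]]].
  exists (a + c), (b + d); split; first by exists a, b, c, d.
  by congr pair; rewrite /l; field; lra.
apply: (triangles_cover (scaled_convex (sum_set_convex cvA cvB)) D).
- case: T => x [y [T0 T1 T2]]; exists (4 / 3 * x), (4 / 3 * y); split.
  + exact: sub.
  + by have := sub _ _ T1; congr scaled; congr pair; field.
  + by have := sub _ _ T2; congr scaled; congr pair; field.
- case: T' => x [y [T0 T1 T2]]; exists (4 / 3 * x), (4 / 3 * y); split.
  + exact: sub.
  + by have := sub _ _ T1; congr scaled; congr pair; field.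
  + by have := sub _ _ T2; congr scaled; congr pair; field.
Qed.

End Plane_coordinates.

(** * From coverings to the infimum *)

Section Covering_radius.
Variable R : realType.
Implicit Types (A B : set (R * R)) (K : set 'rV[R]_2).

Lemma covering_radius_le K (mu : R) :
  0 <= mu -> covers (scaled mu (plane K)) -> (covering_radius K <= mu%:E)%E.
Proof.
by move=> mu0 cov; rewrite covering_radiusE; apply: ereal_inf_lbound; exists mu.
Qed.

Lemma covering_radius_ge K (x : \bar R) :
  (forall mu, 0 < mu -> covers (scaled mu (plane K)) -> (x <= mu%:E)%E) ->
  (x <= covering_radius K)%E.
Proof.
move=> h; rewrite covering_radiusE; apply: le_ereal_inf_tmp => _ [mu [mu0 cov] <-].
by apply: h => //; exact: scaled_covers_gt0 mu0 cov.
Qed.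

Lemma covering_radius_ge0 K : (0 <= covering_radius K)%E.
Proof. by apply: covering_radius_ge => mu mu0 _; rewrite lee_fin ltW. Qed.

Lemma covering_radius_fin K (r : R) : covering_radius K = r%:E ->
  exists2 mu, 0 < mu & covers (scaled mu (plane K)).
Proof.
move=> rE; apply: contrapT => H.
have : (+oo <= covering_radius K)%E.
  by apply: covering_radius_ge => mu mu0 cov; exfalso; apply: H; exists mu.
by rewrite rE.
Qed.

Lemma covering_radius_sum_le K1 K2 : K1 !=set0 ->
  (covering_radius (minkowski_sum K1 K2) <= covering_radius K2)%E.
Proof.
move=> [v Kv]; apply: covering_radius_ge => mu mu0 cov.
apply: covering_radius_le; first exact: ltW.
rewrite plane_minkowski_sum; apply: sum_set_covers => //.
by exists (v 0 0, v 0 1); rewrite /plane /= -vec2_eta.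
Qed.

Lemma minkowski_sumC K1 K2 : minkowski_sum K1 K2 = minkowski_sum K2 K1.
Proof.
by apply/seteqP; split=> _ [v Kv [w Kw <-]]; exists w => //; exists v => //;
  rewrite addrC.
Qed.

(** For the case of a summand with infinite covering radius: its inverse is 0, and monotonicity
    under adding a non-empty set remains. *)
Lemma inve_le_of_le (c c' : \bar R) : (0 <= c)%E -> (c <= c')%E ->
  ((3 / 4)%:E * c'^-1 <= c^-1)%E.
Proof.
move=> c0 cc'; have [->|cn0] := eqVneq c 0%E; first by rewrite inve0 leey.
have {}c0 : (0 < c)%E by rewrite lt_def cn0.
case: c' cc' => [r'| |] cc'; last by rewrite leeNy_eq in cc'; rewrite (eqP cc') in c0.
  case: c c0 {cn0} cc' => [r| |] // c0; rewrite lee_fin => rr'.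
  rewrite lte_fin in c0; have r'0 : 0 < r' by lra.
  rewrite !inver !gt_eqF// -EFinM lee_fin.
  have : r'^-1 <= r^-1 by rewrite lef_pV2.
  have : 0 < r'^-1 by rewrite invr_gt0.
  lra.
by rewrite invey mule0 inve_ge0 ltW.
Qed.

(** Attainment of the infima is avoided: the inequality holds for all admissible factors and passes
    to the infimum in one variable at a time, solved as a >= 3 r b / (4 b - 3 r). *)
Lemma covering_radius_sum_fin K1 K2 (r r1 r2 : R) :
  convex_body K1 -> convex_body K2 ->
  covering_radius K1 = r1%:E -> covering_radius K2 = r2%:E ->
  covering_radius (minkowski_sum K1 K2) = r%:E -> 0 < r ->
  [/\ 0 < r1, 0 < r2 & 3 * r * (r1 + r2) <= 4 * r1 * r2].
Proof.
move=> [_ cK1 vK1] [_ cK2 vK2] r1E r2E rE r0.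
have key mu1 mu2 : 0 < mu1 -> covers (scaled mu1 (plane K1)) ->
    0 < mu2 -> covers (scaled mu2 (plane K2)) ->
    3 * r * (mu1 + mu2) <= 4 * mu1 * mu2.
  move=> m1 cov1 m2 cov2.
  have := scaled_sum_covers (plane_convex vK1) (plane_convex vK2)
    (plane_compact cK1) (plane_compact cK2) m1 m2 cov1 cov2.
  rewrite -plane_minkowski_sum => /covering_radius_le -/(_ _).
  have m12 : 0 < mu1 + mu2 by lra.
  have p0 : 0 <= 4 / 3 * (mu1 * mu2 / (mu1 + mu2)).
    by rewrite mulr_ge0// ?divr_ge0 ?mulr_ge0//; lra.
  move=> /(_ p0); rewrite rE lee_fin mulrA ler_pdivlMr//; lra.
have bound a b c : 0 < a -> 0 < b -> 3 * r * (a + b) <= 4 * a * b ->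
    c = 3 * r * b / (4 * b - 3 * r) -> 0 < 4 * b - 3 * r /\ c <= a.
  move=> a0 b0 h ->; have h' : 3 * r * b <= a * (4 * b - 3 * r) by lra.
  have d0 : 0 < 4 * b - 3 * r.
    by rewrite -(pmulr_rgt0 _ a0); apply: lt_le_trans h'; rewrite !mulr_gt0.
  by rewrite ler_pdivrMr.
have step1 mu2 : 0 < mu2 -> covers (scaled mu2 (plane K2)) ->
    0 < r1 /\ 3 * r * (r1 + mu2) <= 4 * r1 * mu2.
  move=> m2 cov2; have [nu1 n1 c1] := covering_radius_fin r1E.
  have [d0 _] := bound _ _ _ n1 m2 (key _ _ n1 c1 m2 cov2) erefl.
  have le1 : 3 * r * mu2 / (4 * mu2 - 3 * r) <= r1.
    rewrite -lee_fin -r1E; apply: covering_radius_ge => mu1 m1 cov1.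
    by rewrite lee_fin; have [] := bound _ _ _ m1 m2 (key _ _ m1 cov1 m2 cov2) erefl.
  split; first by apply: lt_le_trans le1; rewrite divr_gt0// !mulr_gt0.
  by move: le1; rewrite ler_pdivrMr//; lra.
have [nu2 n2 c2] := covering_radius_fin r2E.
have [r10 h1] := step1 _ n2 c2.
have h2 mu2 : 0 < mu2 -> covers (scaled mu2 (plane K2)) ->
    3 * r * (mu2 + r1) <= 4 * mu2 * r1.
  by move=> m2 cov2; have [_] := step1 _ m2 cov2; lra.
have [d0 _] := bound _ _ _ n2 r10 (h2 _ n2 c2) erefl.
have le2 : 3 * r * r1 / (4 * r1 - 3 * r) <= r2.
  rewrite -lee_fin -r2E; apply: covering_radius_ge => mu2 m2 cov2.
  by rewrite lee_fin; have [] := bound _ _ _ m2 r10 (h2 _ m2 cov2) erefl.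
split=> //; first by apply: lt_le_trans le2; rewrite divr_gt0// !mulr_gt0.
by move: le2; rewrite ler_pdivrMr//; lra.
Qed.

Lemma covering_radius_minkowski_sum K1 K2 : convex_body K1 -> convex_body K2 ->
  ((3 / 4)%:E * ((covering_radius K1)^-1 + (covering_radius K2)^-1) <=
     (covering_radius (minkowski_sum K1 K2))^-1)%E.
Proof.
move=> K1P K2P; have [K10 _ _] := K1P; have [K20 _ _] := K2P.
have le2 := covering_radius_sum_le K2 K10.
have le1 := covering_radius_sum_le K1 K20; rewrite minkowski_sumC in le1.
have c0 := covering_radius_ge0 (minkowski_sum K1 K2).
have c10 := covering_radius_ge0 K1; have c20 := covering_radius_ge0 K2.
(* The inverse of 0 is +oo, so this case is immediate; afterwards the radius of the sum may be taken
   positive. *)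
have [c0E|cn0] := eqVneq (covering_radius (minkowski_sum K1 K2)) 0%E.
  by rewrite c0E inve0 leey.
case r1E : (covering_radius K1) le1 c10 => [r1| |] le1 c10 //; last first.
  by rewrite invey add0e; exact: inve_le_of_le.
case r2E : (covering_radius K2) le2 c20 => [r2| |] le2 c20 //; last first.
  by rewrite invey adde0; exact: inve_le_of_le.
case rE : (covering_radius _) le1 c0 cn0 => [r| |] // le1 c0 cn0.
rewrite lee_fin in c0; rewrite eqe in cn0.
have r0 : 0 < r by rewrite lt_def cn0.
have [r10 r20 h] := covering_radius_sum_fin K1P K2P r1E r2E rE r0.
rewrite !inver !gt_eqF// -EFinD -EFinM lee_fin.
rewrite -[X in X <= _]mulr1 -[X in _ * X <= _](mulfV (lt0r_neq0 r0)) mulrA.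
rewrite -[X in _ <= X]mul1r ler_pM2r ?invr_gt0//.
rewrite (_ : _ * r = 3 * r * (r1 + r2) / (4 * r1 * r2)); last first.
  by field; rewrite !gt_eqF.
by rewrite ler_pdivrMr ?mul1r// !mulr_gt0.
Qed.

Lemma covering_radius_eq K (c : R) : 0 <= c -> covers (scaled c (plane K)) ->
  (forall mu, 0 < mu -> mu < c -> ~ covers (scaled mu (plane K))) ->
  covering_radius K = c%:E.
Proof.
move=> c0 cov ncov; apply/eqP; rewrite eq_le covering_radius_le//=.
apply: covering_radius_ge => mu mu0 covmu; rewrite lee_fin leNgt.
by apply/negP => /(ncov _ mu0).
Qed.

End Covering_radius.

(** * The extremal example *)

Section Example.
Variable R : realType.

(* In the rotated coordinates [x + y] and [y - x] the bodies [P1], [P2] and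
   [P1 + P2] become axis-parallel boxes, and the integer lattice becomes the
   set of pairs of integers of equal parity. *)
Definition tilted_box (p q : R) : set (R * R) :=
  [set r | [/\ 0 <= r.1 + r.2, r.1 + r.2 <= p, 0 <= r.2 - r.1 & r.2 - r.1 <= q]].

Lemma tilted_box_convex p q : planar_convex (tilted_box p q).
Proof.
move=> x y x' y' t [/= ? ? ? ?] [/= ? ? ? ?] t0 t1; split=> /=; nra.
Qed.

Lemma scaled_tilted_box (mu p q : R) : 0 < mu ->
  scaled mu (tilted_box p q) = tilted_box (mu * p) (mu * q).
Proof.
move=> mu0; apply/seteqP; split=> [_ [x [y [[/= ? ? ? ?] ->]]]|[x y] [/= h1 h2 h3 h4]].
  by split=> /=; nra.
have mun0 : mu != 0 by rewrite gt_eqF.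
exists (x / mu), (y / mu); split; last by congr pair; field.
have mu_ge0 := ltW mu0.
by split; rewrite /= -?mulrDl -?mulrBl ?divr_ge0// ler_pdivrMr// mulrC.
Qed.

Lemma sum_tilted_box (p q p' q' : R) : 0 < p -> 0 < q -> 0 < p' -> 0 < q' ->
  sum_set (tilted_box p q) (tilted_box p' q') = tilted_box (p + p') (q + q').
Proof.
move=> p0 q0 p0' q0'; apply/seteqP; split.
  by move=> _ [x [y [x' [y' [[/= ? ? ? ?] [/= ? ? ? ?] ->]]]]]; split=> /=; lra.
move=> [x y] [/= h1 h2 h3 h4].
pose s := (x + y) / (p + p'); pose t := (y - x) / (q + q').
have s0 : 0 <= s by rewrite divr_ge0; lra.
have s1 : s <= 1 by rewrite ler_pdivrMr; lra.
have t0 : 0 <= t by rewrite divr_ge0; lra.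
have t1 : t <= 1 by rewrite ler_pdivrMr; lra.
have pn0 : p + p' != 0 by lra.
have qn0 : q + q' != 0 by lra.
exists ((s * p - t * q) / 2), ((s * p + t * q) / 2),
  ((s * p' - t * q') / 2), ((s * p' + t * q') / 2); split.
- by split=> /=; nra.
- by split=> /=; nra.
- by congr pair; rewrite /s /t; field; rewrite pn0 qn0.
Qed.

Lemma parallelogram_convex_body (u v : 'rV[R]_2) :
  convex_body (parallelogram u v).
Proof.
split.
- by exists 0; exists 0; [|exists 0]; rewrite /= ?in_itv /= ?lexx ?ler01 ?scale0r ?addr0.
- rewrite (_ : parallelogram u v = (fun p : R * R => p.1 *: u + p.2 *: v) @`
      (`[0, 1]%classic `*` `[0, 1]%classic)).
    apply: continuous_compact; last by apply: compact_setX; exact: segment_compact.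
    apply: continuous_subspaceT => p.
    by apply: cvgD; apply: cvgZr_tmp; [exact: fst_continuous|exact: snd_continuous].
  apply/seteqP; split=> [_ [a a01 [b b01 <-]]|_ [[a b] [/= a01 b01] <-]].
    by exists (a, b).
  by exists a => //; exists b.
- move=> x y t; rewrite !inE => -[a /= + [b /= + <-]] [c /= + [d /= + <-]].
  rewrite !in_itv /= => a01 b01 c01 d01.
  have t0 : 0 <= t%:num by []. have t1 : t%:num <= 1 by [].
  exists (t%:num * a + (1 - t%:num) * c); first by rewrite /= in_itv /=; nra.
  exists (t%:num * b + (1 - t%:num) * d); first by rewrite /= in_itv /=; nra.
  rewrite /conv /=; set s := 1 - _; rewrite (_ : unstable.onem _ = s)//.
  clearbody s.
  by rewrite !scalerDl !scalerDr !scalerA addrACA.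
Qed.

Lemma plane_P1 : plane (P1 R) = tilted_box 2 1.
Proof.
apply/seteqP; split=> -[x y]; rewrite /plane /=.
  move=> [a + [b]]; rewrite /= !in_itv /= => a01 b01.
  by rewrite !vec2Z vec2D => /vec2_inj[<- <-]; split=> /=; lra.
move=> [/= h1 h2 h3 h4].
exists ((x + y) / 2); first by rewrite /= in_itv /=; lra.
exists (y - x); first by rewrite /= in_itv /=; lra.
by rewrite !vec2Z vec2D; congr vec2; field.
Qed.

Lemma plane_P2 : plane (P2 R) = tilted_box 1 2.
Proof.
apply/seteqP; split=> -[x y]; rewrite /plane /=.
  move=> [a + [b]]; rewrite /= !in_itv /= => a01 b01.
  by rewrite !vec2Z vec2D => /vec2_inj[<- <-]; split=> /=; lra.
move=> [/= h1 h2 h3 h4].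
exists ((y - x) / 2); first by rewrite /= in_itv /=; lra.
exists (x + y); first by rewrite /= in_itv /=; lra.
by rewrite !vec2Z vec2D; congr vec2; field.
Qed.

Lemma no_int_between (k : int) : 0 < k%:~R :> R -> k%:~R < 1 :> R -> False.
Proof. by rewrite (_ : 1 = 1%:~R)// ltr_int ltr0z; lia. Qed.

Lemma tilted_box_covers21 : covers (tilted_box 2 1).
Proof.
apply: (@triangles_cover R _ 1 1 0 1); [exact: tilted_box_convex|by []| |].
- by exists 0, 0; split; split=> /=; lra.
- by exists (1 / 2), (3 / 2); split; split=> /=; lra.
Qed.

Lemma tilted_box_covers12 : covers (tilted_box 1 2).
Proof.
apply: (@triangles_cover R _ (-1) 1 0 1); [exact: tilted_box_convex|by []| |].
- by exists 0, 0; split; split; rewrite /= ?mulrN1z; lra.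
- by exists (- (1 / 2)), (3 / 2); split; split; rewrite /= ?mulrN1z; lra.
Qed.

Lemma tilted_box_covers22 : covers (tilted_box 2 2).
Proof.
apply: (@triangles_cover R _ 1 0 0 1); [exact: tilted_box_convex|by []| |].
- by exists (- (1 / 2)), (1 / 2); split; split=> /=; lra.
- by exists (1 / 2), (3 / 2); split; split=> /=; lra.
Qed.

(** Lattice translations change y - x by integers, so a box of width below 1 in this coordinate
    misses whole strips. *)
Lemma tilted_box_ncovers_right p q : 0 < q -> q < 1 -> ~ covers (tilted_box p q).
Proof.
move=> q0 q1 cov; have [m [n [/= _ _ h1 h2]]] := cov 0 ((1 + q) / 2).
by apply: (@no_int_between (n - m)); rewrite intrB; lra.
Qed.

Lemma tilted_box_ncovers_left p q : 0 < p -> p < 1 -> ~ covers (tilted_box p q).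
Proof.
move=> p0 p1 cov; have [m [n [/= h1 h2 _ _]]] := cov 0 ((1 + p) / 2).
by apply: (@no_int_between (n + m)); rewrite intrD; lra.
Qed.

Lemma tilted_box_ncovers_square p : 0 < p -> p < 2 -> ~ covers (tilted_box p p).
Proof.
(* The point has rotated coordinates p / 2 and 1 + p / 2, i.e. the centre of the box shifted by (0,
   1), a pair of unequal parity. For p < 2 no other pair of integers can serve. *)
move=> p0 p2 cov; have [m [n [/= h1 h2 h3 h4]]] := cov (- (1 / 2)) ((1 + p) / 2).
have mn0 : n + m = 0.
  have : ((-1)%:~R < (n + m)%:~R :> R) by rewrite intrD mulrN1z; lra.
  have : ((n + m)%:~R < 1%:~R :> R) by rewrite intrD; lra.
  rewrite !ltr_int; lia.
have nm1 : n - m = 1.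
  have : (0%:~R < (n - m)%:~R :> R) by rewrite intrB; lra.
  have : ((n - m)%:~R < 2%:~R :> R) by rewrite intrB; lra.
  rewrite !ltr_int; lia.
lia.
Qed.

Lemma covering_radius_P1 : covering_radius (P1 R) = 1%:E.
Proof.
apply: covering_radius_eq => //.
  by rewrite plane_P1 scaled_tilted_box// !mul1r; exact: tilted_box_covers21.
move=> mu mu0 mu1; rewrite plane_P1 scaled_tilted_box//.
by apply: tilted_box_ncovers_right; lra.
Qed.

Lemma covering_radius_P2 : covering_radius (P2 R) = 1%:E.
Proof.
apply: covering_radius_eq => //.
  by rewrite plane_P2 scaled_tilted_box// !mul1r; exact: tilted_box_covers12.
move=> mu mu0 mu1; rewrite plane_P2 scaled_tilted_box//.
by apply: tilted_box_ncovers_left; lra.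
Qed.

Lemma covering_radius_P1_P2 :
  covering_radius (minkowski_sum (P1 R) (P2 R)) = (2 / 3)%:E.
Proof.
have planeE : plane (minkowski_sum (P1 R) (P2 R)) = tilted_box 3 3.
  by rewrite plane_minkowski_sum plane_P1 plane_P2 sum_tilted_box//;
    congr tilted_box; lra.
apply: covering_radius_eq; first lra.
  rewrite planeE scaled_tilted_box; last lra.
  by rewrite (_ : 2 / 3 * 3 = 2); [exact: tilted_box_covers22|field].
move=> mu mu0 mu1; rewrite planeE scaled_tilted_box//.
by apply: tilted_box_ncovers_square; lra.
Qed.

End Example.

Theorem theorem1p4 (R : realType) :
  (forall K1 K2 : set 'rV[R]_2,
     convex_body K1 -> convex_body K2 ->
     ((3 / 4)%:E * ((covering_radius K1)^-1 + (covering_radius K2)^-1) <=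
        (covering_radius (minkowski_sum K1 K2))^-1)%E)
  /\
  [/\ convex_body (P1 R), convex_body (P2 R) &
      ((covering_radius (minkowski_sum (P1 R) (P2 R)))^-1 =
         (3 / 4)%:E *
           ((covering_radius (P1 R))^-1 + (covering_radius (P2 R))^-1))%E].
Proof.
split; first exact: covering_radius_minkowski_sum.
split; [exact: parallelogram_convex_body|exact: parallelogram_convex_body|].
rewrite covering_radius_P1_P2 covering_radius_P1 covering_radius_P2 inve1.
rewrite -EFinD -EFinM inver gt_eqF; last lra.
by congr EFin; field.
Qed.
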